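(* Let $L>1$ and, for each $d\ge 1$, let $\mathcal{P}_{0,d}(L)$ be the class of distributions $P$ on $\mathbb{R}^d$ that satisfy the Lyapunov-ratio assumption with constant $L$ and have mean $\mu=0$. Let $m_1,m_2$ be positive integers, $n=m_1+m_2$, and let $X_1,\dots,X_n$ be i.i.d. from $P$. Then there exists an absolute constant $C>0$ such that $$\sup_{d\ge 1}\ \sup_{P\in\mathcal{P}_{0,d}(L)}\ \sup_{-\infty<z<\infty}\bigl|P(T_{\mathrm{mean}}\le z)-\Phi(z)\bigr|\le \frac{CL}{\sqrt{m_1}} .$$
   Context: $\Phi$ is the cumulative distribution function of $N(0,1)$. Lyapunov-ratio assumption with constant $L>1$: $X$ is a random vector having a continuous distribution $P$ in $\mathbb{R}^d$ with mean $\mu$ and $$\sup_{u\in\mathbb{S}^{d-1}}\frac{\{\mathbb{E}_P[|u^\top(X-\mu)|^3]\}^{1/3}}{\{\mathbb{E}_P[|u^\top(X-\mu)|^2]\}^{1/2}}\le L^{1/3},$$ where $\mathbb{S}^{d-1}$ is the unit sphere of $\mathbb{R}^d$. Test statistic: let $f_{\mathrm{mean}}(x)=\frac1{m_2}\sum_{j=m_1+1}^{n}X_j^\top x$ and $\overline f_{\mathrm{mean}}=\frac1{m_1}\sum_{i=1}^{m_1}f_{\mathrm{mean}}(X_i)$. Then $$T_{\mathrm{mean}}=\frac{\sqrt{m_1}\,\overline f_{\mathrm{mean}}}{\sqrt{m_1^{-1}\sum_{i=1}^{m_1}\{f_{\mathrm{mean}}(X_i)-\overline f_{\mathrm{mean}}\}^2}}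 .$$ ''Absolute'' means that $C$ does not depend on $L,d,P,m_1,m_2$. *)

(* Defs.v *)
From HB Require Import structures.
From mathcomp Require Import all_boot all_order all_algebra.
From mathcomp Require Import all_classical all_reals all_analysis.

Set Implicit Arguments.
Unset Strict Implicit.
Unset Printing Implicit Defensive.

Import Order.TTheory GRing.Theory Num.Theory.

Local Open Scope classical_set_scope.
Local Open Scope ring_scope.

(** [R^d] is [d.-tuple R], with the product of the Borel sigma-algebras. *)

Section euclidean.
Context (R : realType) (d : nat).
Implicit Types x y : d.-tuple R.

Definition origin : d.-tuple R := [tuple 0 | k < d].

Definition dot x y : R := \sum_(k < d) tnth x k * tnth y k.

Definition vsub x y : d.-tuple R := [tuple tnth x k - tnth y k | k < d].

Definition unit_sphere : set (d.-tuple R) :=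
  [set u | Num.sqrt (dot u u) = 1].

End euclidean.

Section distributions.
Context (R : realType) (d : nat).
Implicit Types (P : probability (d.-tuple R) R) (mu u : d.-tuple R) (L : R).

(** Continuous in the sense of having no atoms; this contains the
    distributions that have a density. *)
Definition continuous_distribution P : Prop :=
  forall x : d.-tuple R, P [set x] = 0%E.

Definition has_mean P mu : Prop :=
  forall k : 'I_d,
    P.-integrable setT (fun x => (tnth x k)%:E) /\
    ('E_P[fun x : d.-tuple R => tnth x k] = (tnth mu k)%:E)%E.

Definition abs_moment P mu u (p : nat) : \bar R :=
  ('E_P[fun x : d.-tuple R => (`|dot u (vsub x mu)| ^+ p)%R])%E.

(** Division in [\bar R] is total, with [0 / 0 = 0] and [+oo / +oo = 0]; the
    first conjunct requires the quotient to be meaningful in every direction.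
    The third moment is allowed to be [+oo] there, and is then excluded by the
    second conjunct. *)
Definition lyapunov_ratio P mu L : Prop :=
  (forall u, unit_sphere u -> (0 < abs_moment P mu u 2 < +oo)%E) /\
  (ereal_sup [set (abs_moment P mu u 3 `^ (3^-1)%R /
                   abs_moment P mu u 2 `^ (2^-1)%R)%E | u in @unit_sphere R d]
   <= (L `^ 3^-1)%:E)%E.

Definition lyapunov_assumption L P mu : Prop :=
  [/\ continuous_distribution P, has_mean P mu & lyapunov_ratio P mu L].

Definition P0 L : set (probability (d.-tuple R) R) :=
  [set P | lyapunov_assumption L P (origin R d)].

End distributions.

Section iid.
Context (R : realType) (dO dT : measure_display) (Omega : measurableType dO)
  (T : measurableType dT) (Pr : probability Omega R) (n : nat).
Implicit Types (X : 'I_n -> {RV Pr >-> T}).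

Definition mutually_independent X : Prop :=
  forall (J : {set 'I_n}) (A : 'I_n -> set T), (forall i, measurable (A i)) ->
  (Pr (\bigcap_(i in [set` J]) (X i @^-1` A i)) =
   \prod_(i in J) Pr (X i @^-1` A i))%E.

Definition iid X (P : probability T R) : Prop :=
  mutually_independent X /\
  forall i (A : set T), measurable A -> distribution Pr (X i) A = P A.

End iid.

(** [lshift m2 i] runs over the first [m1] sample points and [rshift m1 j] over
    the last [m2] ones.  [T_mean] is set to [0] where its denominator vanishes
    (in particular everywhere if [m1 = 1]), by the convention [x / 0 = 0]. *)
Section statistic.
Context (R : realType) (d m1 m2 : nat).
Implicit Type x : 'I_(m1 + m2) -> d.-tuple R.

Definition f_mean x (v : d.-tuple R) : R :=
  m2%:R^-1 * \sum_(j < m2) dot (x (rshift m1 j)) v.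

Definition f_mean_bar x : R :=
  m1%:R^-1 * \sum_(i < m1) f_mean x (x (lshift m2 i)).

Definition T_mean x : R :=
  Num.sqrt m1%:R * f_mean_bar x /
  Num.sqrt (m1%:R^-1 *
    \sum_(i < m1) (f_mean x (x (lshift m2 i)) - f_mean_bar x) ^+ 2).

End statistic.

Definition Phi (R : realType) (z : R) : \bar R :=
  @normal_prob R 0 1 `]-oo, z].

(** The values [|Pr (T_mean <= z) - Phi z|], for all [z] and all realizations
    of an i.i.d. sample from [P] on a probability space; for a given [z] the
    value depends on [P] only. *)
Definition cdf_errors (R : realType) (d m1 m2 : nat)
    (P : probability (d.-tuple R) R) : set (\bar R) :=
  [set e | exists (dO : measure_display) (Omega : measurableType dO)
      (Pr : probability Omega R) (X : 'I_(m1 + m2) -> {RV Pr >-> d.-tuple R})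
      (z : R),
    iid X P /\
    e = (`|Pr [set w | (T_mean (fun i => X i w) <= z)%R] - Phi z|)%E].

(* Main.v *)
Require Import Defs.
From HB Require Import structures.
From mathcomp Require Import all_boot all_order all_algebra.
From mathcomp Require Import all_classical all_reals all_analysis.
From mathcomp Require Import measurable_realfun measurable_fun_approximation.
From mathcomp Require Import ring lra.
Import Order.TTheory GRing.Theory Num.Theory.
Import numFieldNormedType.Exports.
Local Open Scope classical_set_scope.
Local Open Scope ring_scope.

(** Write [a] for the average of the last [m2] observations. Given these, the
    numbers [dot a (X i)], [i < m1], are independent and identically
    distributed, [f_mean] evaluated at [X i] is [dot a (X i)], and [T_mean] is
    Student's statistic of these numbers. As [P] has no atoms, [a] is almost
    surely nonzero ([degenerate_null]), and then the Lyapunov assumption, read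
    in the direction of [a], bounds the third absolute moment of [dot a (X i)]
    by [L] times the cube of its standard deviation
    ([direction_moments]). This bound does not involve [a], so that the
    theorem follows by Fubini ([Ex_resampling]) from a Berry-Esseen bound for
    Student's statistic of independent real variables, with a constant that
    depends on the third moment ratio only ([student_berry_esseen]).

    Student's statistic is unchanged by rescaling, so the variables may be
    normalized to [X i] with variances adding up to [1]; let [gamma] bound the
    sum of the third absolute moments, [S] be the sum of the [X i] and [U] the
    sum of their squares. Student's statistic is an increasing function of
    [S / sqrt U], which turns the level [z] into
    [z / sqrt (1 + z ^ 2 / m)] ([student_le]); the normal distribution function
    hardly sees this change of level ([gauss_cdf_shrink]). It remains to compare
    [W = S * g U] with a normal variable, where [g] is the inverse square root,
    frozen outside [[1/2, 3/2]]; [U] leaves that interval with probability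
    [O(gamma)] ([sqr_sum_deviation]).

    The comparison is Stein's method. Let [f] be the bounded solution of
    [f' w - w * f w = 1_(w <= z) - Phi z]. The error at level [z] is the
    expectation of [f' W - W * f W], and [W * f W] is the sum over [i] of
    [X i * F S U] with [F s u = g u * f (s * g u)]. Let [S'] and [U'] be the sums
    without the [i]-th variable. Since [X i] is centered and independent of
    [(S', U')], [F S U] may be replaced by [F S U - F S' U']
    ([Ex_leave_one_out]). To first order this difference is
    [X i * g U ^ 2 * f' W]: the change of [U] by [X i ^ 2] costs a third moment
    only. Summing over [i] gives [U * g U ^ 2 * f' W], and [U * g U ^ 2 = 1]
    near [U = 1], so the main terms cancel exactly. This is why a third
    moment is enough, although the fluctuations of [U] itself are then not of
    order [gamma], and why all bounds are uniform in [z].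

    The one delicate error comes from the jump of [f'] at [z]: it is the
    expectation of [X i ^ 2] on the event that [W] is within [|X i| * g U] of
    [z]. Conditionally on [X i] this is an event about [S'] and [U'] whose
    probability is [O(|X i| + gamma)], by a concentration inequality
    ([concentration]) that follows from the same leave-one-out computation with
    [f] replaced by a truncated linear function. *)

Set Implicit Arguments.
Unset Strict Implicit.
Unset Printing Implicit Defensive.

(** * The normal distribution and its Stein equation *)

Section gauss.
Context (R : realType).
Implicit Types w z b : R.

Definition gauss_density w : R := normal_pdf 0 1 w.
Definition gauss_cdf z : R := fine (Phi z).

Lemma gauss_densityE w :
  gauss_density w = normal_peak (1 : R) * expR (- w ^+ 2 / 2).
Proof.
rewrite /gauss_density normal_pdfE ?oner_neq0// /normal_fun subr0.
by rewrite expr1n.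
Qed.

Lemma gauss_cdfE z : Phi z = (gauss_cdf z)%:E.
Proof. by rewrite /gauss_cdf fineK// fin_num_measure. Qed.

Lemma gauss_cdf_ge0 z : 0 <= gauss_cdf z.
Proof. by rewrite -lee_fin -gauss_cdfE. Qed.

Lemma gauss_cdf_le1 z : gauss_cdf z <= 1.
Proof. by rewrite -lee_fin -gauss_cdfE probability_le1. Qed.

Lemma gauss_cdf_le : {homo gauss_cdf : w z / w <= z}.
Proof.
move=> w z wz; rewrite -lee_fin -!gauss_cdfE le_measure ?inE//.
exact: subitvPr.
Qed.

Let idm : measurableTypeR R -> R := idfun.

#[local] HB.instance Definition _ :=
  @isMeasurableFun.Build _ _ _ _ idm (@measurable_id _ _ setT).

Let idRV : {RV (@normal_prob R 0 1) >-> R} := idm.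

Lemma cdf_idRV z : cdf idRV z = (gauss_cdf z)%:E.
Proof. by rewrite -gauss_cdfE. Qed.

Lemma gauss_cdf_cvgy : gauss_cdf x @[x --> +oo] --> (1 : R).
Proof.
have := cvg_cdfy1 idRV.
rewrite (_ : cdf idRV = EFin \o gauss_cdf); last exact/funext/cdf_idRV.
exact: fine_cvg.
Qed.

Lemma gauss_cdf_cvgNy : gauss_cdf x @[x --> -oo] --> (0 : R).
Proof.
have := cvg_cdfNy0 idRV.
rewrite (_ : cdf idRV = EFin \o gauss_cdf); last exact/funext/cdf_idRV.
exact: fine_cvg.
Qed.

Global Instance is_derive_gauss_cdf w : is_derive w 1 gauss_cdf (gauss_density w).
Proof.
have [] := @continuous_FTC1 R (@gauss_density) -oo%O w (w + 1).
- by rewrite ltrDl.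
- apply: (integrableS measurableT) => //.
  exact: integrable_normal_pdf.
- by rewrite ltNyr.
- by apply: continuous_normal_pdf; exact: oner_neq0.
move=> d1 d2; apply: DeriveDef; first exact: d1.
by rewrite -derive1E; exact: d2.
Qed.

Lemma MVT_real (f df : R -> R) (a b : R) : a <= b ->
  (forall x : R, is_derive x (1 : R) f (df x)) ->
  exists2 c, a <= c <= b & f b - f a = df c * (b - a).
Proof.
move=> ab fdf.
have [|c cab ->] := @MVT_segment R f df a b ab (fun x _ => fdf x).
  apply: derivable_within_continuous => x _.
  by have [] := fdf x.
by exists c => //; rewrite in_itv/= in cab.
Qed.

Lemma gauss_density_gt0 w : 0 < gauss_density w.
Proof.
by rewrite gauss_densityE mulr_gt0 ?expR_gt0// normal_peak_gt0 ?oner_neq0.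
Qed.

Lemma is_derive_gauss_density w :
  is_derive w (1 : R) gauss_density (- w * gauss_density w).
Proof.
rewrite (_ : gauss_density =
    normal_peak (1 : R) \*: (expR \o (fun w => - w ^+ 2 / 2))); last first.
  by apply/funext => x /=; rewrite gauss_densityE.
have h : is_derive w (1 : R) (fun w : R => - w ^+ 2 / 2) (- w).
  rewrite (_ : (fun w : R => _) = (- 2^-1) \*: ((@id R) ^+ 2)); last first.
    by apply/funext => x /=; rewrite /GRing.scale/= mulNr mulNr mulrC.
  apply: is_derive_eq; rewrite /GRing.scale/= expr1 mulr1.
  by field.
apply: is_derive_eq; rewrite /GRing.scale/= /GRing.scale/=.
ring.
Qed.

(** The Mills ratio bound without an improper integral: as [x] grows beyond [w],
    [gauss_density x / w] decreases at the rate [x / w >= 1] times the density,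
    hence at least as fast as [gauss_cdf] increases. *)
Lemma gauss_cdf_increment_right w b : 0 < w -> w <= b ->
  gauss_cdf b - gauss_cdf w <= gauss_density w / w.
Proof.
move=> w0 wb.
have dk x : is_derive x (1 : R) (gauss_cdf + w^-1 \*: gauss_density)
    (gauss_density x + w^-1 * (- x * gauss_density x)).
  by apply: is_deriveD; apply: is_deriveZ; exact: is_derive_gauss_density.
have [c /andP[wc cb]] := MVT_real wb dk.
have gc := gauss_density_gt0 c; have gb := gauss_density_gt0 b.
rewrite !fctE /= /GRing.scale/= => e.
have : (gauss_density c + w^-1 * (- c * gauss_density c)) * (b - w) <= 0.
  rewrite mulr_le0_ge0 ?subr_ge0//.
  rewrite mulNr mulrN mulrA subr_le0 ler_peMl ?(ltW gc)//.
  by rewrite ler_pdivlMl// mulr1.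
rewrite -e; have : 0 <= w^-1 * gauss_density b by rewrite mulr_ge0 ?invr_ge0 ?ltW.
rewrite [_ / w]mulrC; lra.
Qed.

Lemma gauss_cdf_increment_left w b : w < 0 -> b <= w ->
  gauss_cdf w - gauss_cdf b <= gauss_density w / - w.
Proof.
move=> w0 bw.
have dk x : is_derive x (1 : R) (gauss_cdf + w^-1 \*: gauss_density)
    (gauss_density x + w^-1 * (- x * gauss_density x)).
  by apply: is_deriveD; apply: is_deriveZ; exact: is_derive_gauss_density.
have [c /andP[bc cw]] := MVT_real bw dk.
have gc := gauss_density_gt0 c; have gb := gauss_density_gt0 b.
rewrite !fctE /= /GRing.scale/= => e.
have : (gauss_density c + w^-1 * (- c * gauss_density c)) * (w - b) <= 0.
  rewrite mulr_le0_ge0 ?subr_ge0//.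
  rewrite mulNr mulrN mulrA subr_le0 ler_peMl ?(ltW gc)//.
  by rewrite -ler_ndivlMl// ?invr_lt0// invrK mulr1.
rewrite -e; have : w^-1 * gauss_density b <= 0.
  by rewrite mulr_le0_ge0 ?invr_le0 ?ltW.
rewrite invrN mulrN [_ / w]mulrC; lra.
Qed.

Lemma gauss_tail_right w : 0 < w -> 1 - gauss_cdf w <= gauss_density w / w.
Proof.
move=> w0; rewrite lerBlDr; apply: (cvgr_to_le gauss_cdf_cvgy).
near=> b; rewrite -lerBlDr; apply: gauss_cdf_increment_right => //.
Unshelve. all: by end_near. Qed.

Lemma gauss_tail_left w : w < 0 -> gauss_cdf w <= gauss_density w / - w.
Proof.
move=> w0; rewrite -subr_le0; apply: (cvgr_to_ge gauss_cdf_cvgNy).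
near=> b; rewrite lerBlDr -lerBlDl; apply: gauss_cdf_increment_left => //.
Unshelve. all: by end_near. Qed.


(** The bounded solution [f] of the Stein equation
    [f' w - w * f w = 1_(w <= z) - Phi z]. *)
Definition stein_sol z w : R :=
  (if w <= z then (1 - gauss_cdf z) * gauss_cdf w
   else gauss_cdf z * (1 - gauss_cdf w)) / gauss_density w.

(** The derivative of [stein_sol z] as the Stein equation prescribes it; at the
    corner [z] this is the left derivative. *)
Definition stein_deriv z w : R :=
  w * stein_sol z w + ((w <= z)%R%:R - gauss_cdf z).

Lemma stein_sol_ge0 z w : 0 <= stein_sol z w.
Proof.
rewrite /stein_sol divr_ge0// ?(ltW (gauss_density_gt0 _))//.
by case: ifP => _; rewrite mulr_ge0 ?gauss_cdf_ge0// subr_ge0 gauss_cdf_le1.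
Qed.

Lemma stein_sol_le_right z w : stein_sol z w <= (1 - gauss_cdf w) / gauss_density w.
Proof.
rewrite /stein_sol ler_pM2r ?invr_gt0 ?gauss_density_gt0//.
have := gauss_cdf_le1 w; have := gauss_cdf_ge0 w.
have := gauss_cdf_le1 z; have := gauss_cdf_ge0 z.
case: ifP => [/gauss_cdf_le|]; nra.
Qed.

Lemma stein_sol_le_left z w : stein_sol z w <= gauss_cdf w / gauss_density w.
Proof.
rewrite /stein_sol ler_pM2r ?invr_gt0 ?gauss_density_gt0//.
have := gauss_cdf_le1 w; have := gauss_cdf_ge0 w.
have := gauss_cdf_le1 z; have := gauss_cdf_ge0 z.
case: ifP => [_|/negbT]; first nra.
by rewrite -ltNge => /ltW /gauss_cdf_le; nra.
Qed.

(** The numerator of [stein_sol z w] is at most each of the two tails at [w], and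
    the Mills ratio bound controls the one on the side of [w]. *)
Lemma normr_mul_stein_sol z w : `|w * stein_sol z w| <= 1.
Proof.
rewrite normrM (ger0_norm (stein_sol_ge0 _ _)).
have gw := gauss_density_gt0 w.
have [w0|w0|->] := ltgtP w 0; last by rewrite normr0 mul0r.
- rewrite ltr0_norm// -ler_pdivlMl ?oppr_gt0// mulr1.
  apply: (le_trans (stein_sol_le_left _ _)).
  by rewrite ler_pdivrMr// mulrC gauss_tail_left.
- rewrite gtr0_norm// -ler_pdivlMl// mulr1.
  apply: (le_trans (stein_sol_le_right _ _)).
  by rewrite ler_pdivrMr// mulrC gauss_tail_right.
Qed.

Definition stein_bound : R := (gauss_density 1)^-1 + 2.

Lemma gauss_density1_le w : `|w| <= 1 -> gauss_density 1 <= gauss_density w.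
Proof.
move=> w1; rewrite !gauss_densityE ler_pM2l ?normal_peak_gt0 ?oner_neq0//.
rewrite ler_expR ler_pM2r// lerN2 expr1n -real_normK ?num_real//.
by rewrite exprn_ile1.
Qed.

(** Away from [[-1, 1]] this follows from the bound on [w * stein_sol z w]; inside,
    the density is at least its value at [1]. *)
Lemma normr_stein_sol z w : `|stein_sol z w| <= stein_bound.
Proof.
have gp := gauss_density_gt0 1.
have gi : 0 < (gauss_density 1)^-1 by rewrite invr_gt0.
rewrite /stein_bound; have [w1|w1] := lerP `|w| 1.
  rewrite ger0_norm ?stein_sol_ge0//.
  apply: (le_trans (stein_sol_le_left _ _)).
  have : gauss_cdf w / gauss_density w <= 1 * (gauss_density 1)^-1.
    rewrite ler_pM ?gauss_cdf_ge0 ?gauss_cdf_le1//.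
      by rewrite invr_ge0 ltW ?gauss_density_gt0.
    by rewrite lef_pV2 ?posrE ?gauss_density_gt0// gauss_density1_le.
  lra.
have := normr_mul_stein_sol z w; rewrite normrM.
have : 0 <= `|stein_sol z w| by [].
nra.
Qed.

Lemma stein_bound_ge2 : 2 <= stein_bound.
Proof. by rewrite lerDr invr_ge0 ltW ?gauss_density_gt0. Qed.

Lemma normr_stein_deriv z w : `|stein_deriv z w| <= 2.
Proof.
rewrite /stein_deriv (le_trans (ler_normD _ _))//.
have : `|(w <= z)%R%:R - gauss_cdf z| <= 1.
  have := gauss_cdf_le1 z; have := gauss_cdf_ge0 z.
  by rewrite ler_norml; case: (w <= z)%R => /=; lra.
have := normr_mul_stein_sol z w; lra.
Qed.

Lemma is_derive_invr_gauss_density w :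
  is_derive w (1 : R) (fun x => (gauss_density x)^-1) (w / gauss_density w).
Proof.
have g0 : gauss_density w != 0 by rewrite gt_eqF// gauss_density_gt0.
apply: is_derive_eq; first exact: (is_deriveV g0 (is_derive_gauss_density w)).
by rewrite /GRing.scale/=; field.
Qed.

Lemma is_derive_mills w :
  is_derive w (1 : R) (fun x => gauss_cdf x / gauss_density x)
    (1 + w * (gauss_cdf w / gauss_density w)).
Proof.
have g0 : gauss_density w != 0 by rewrite gt_eqF// gauss_density_gt0.
apply: is_derive_eq.
  exact: (is_deriveM (is_derive_gauss_cdf w) (is_derive_invr_gauss_density w)).
by rewrite /GRing.scale/=; field.
Qed.

Lemma MVT_sym (f df : R -> R) (a b : R) :
  (forall x : R, is_derive x (1 : R) f (df x)) ->
  exists c, [/\ Num.min a b <= c, c <= Num.max a b &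
    f a - f b = df c * (a - b)].
Proof.
move=> fdf; have [ab|/ltW ba] := leP a b.
  have [c /andP[ac cb] e] := MVT_real ab fdf.
  by exists c; split => //; rewrite -opprB e -mulrN opprB.
have [c /andP[ac cb] e] := MVT_real ba fdf.
by exists c.
Qed.

(** To the left of [z] the solution coincides with a smooth function, whose
    derivative the Stein equation expresses through the solution itself. *)
Lemma MVT_stein_sol_left z w v : w <= z -> v <= z -> exists2 c,
  `|c - w| <= `|w - v| &
  stein_sol z w - stein_sol z v =
    (c * stein_sol z c + (1 - gauss_cdf z)) * (w - v).
Proof.
move=> wz vz.
have d x : is_derive x (1 : R)
    ((1 - gauss_cdf z) \*: (fun x => gauss_cdf x / gauss_density x))
    ((1 - gauss_cdf z) * (1 + x * (gauss_cdf x / gauss_density x))).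
  by apply: is_deriveZ; exact: is_derive_mills.
have [c [wc cv]] := MVT_sym w v d.
have cz : c <= z by rewrite (le_trans cv)// ge_max wz vz.
rewrite /= /GRing.scale/= !mulrA => e; exists c.
  move: wc cv; have [wv|/ltW wv] := leP w v => wc cv.
    by rewrite ger0_norm ?subr_ge0// distrC ger0_norm ?subr_ge0//; lra.
  by rewrite distrC ger0_norm ?subr_ge0// ger0_norm ?subr_ge0//; lra.
by rewrite /stein_sol wz vz cz e; ring.
Qed.

Lemma MVT_stein_sol_right z w v : z <= w -> z <= v -> exists2 c,
  `|c - w| <= `|w - v| &
  stein_sol z w - stein_sol z v =
    (c * stein_sol z c - gauss_cdf z) * (w - v).
Proof.
move=> zw zv.
have d x : is_derive x (1 : R)
    (gauss_cdf z \*: ((fun x => (gauss_density x)^-1) -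
       (fun x => gauss_cdf x / gauss_density x)))
    (gauss_cdf z * (x / gauss_density x -
       (1 + x * (gauss_cdf x / gauss_density x)))).
  apply: is_deriveZ; apply: is_deriveB.
    exact: is_derive_invr_gauss_density.
  exact: is_derive_mills.
have solE x : z <= x ->
    stein_sol z x = gauss_cdf z * ((gauss_density x)^-1 -
       gauss_cdf x / gauss_density x).
  rewrite /stein_sol le_eqVlt => /predU1P[<-|zx].
    by rewrite lexx; ring.
  by rewrite leNgt zx /=; ring.
have [c [wc cv]] := MVT_sym w v d.
have zc : z <= c by rewrite (le_trans _ wc)// le_min zw zv.
rewrite !fctE /= /GRing.scale/= => e; exists c.
  move: wc cv; have [wv|/ltW wv] := leP w v => wc cv.
    by rewrite ger0_norm ?subr_ge0// distrC ger0_norm ?subr_ge0//; lra.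
  by rewrite distrC ger0_norm ?subr_ge0// ger0_norm ?subr_ge0//; lra.
by rewrite !solE// e; ring.
Qed.

Lemma stein_slope_le z c (b : bool) :
  `|c * stein_sol z c + (b%:R - gauss_cdf z)| <= 2.
Proof.
rewrite (le_trans (ler_normD _ _))//.
have : `|b%:R - gauss_cdf z| <= 1.
  have := gauss_cdf_le1 z; have := gauss_cdf_ge0 z.
  by rewrite ler_norml; case: b => /=; lra.
have := normr_mul_stein_sol z c; lra.
Qed.

(** On each side of [z] by the mean value theorem, and across [z] because the
    solution is continuous there. *)
Lemma stein_sol_lipschitz z w v :
  `|stein_sol z w - stein_sol z v| <= 2 * `|w - v|.
Proof.
have lip_left x y : x <= z -> y <= z ->
    `|stein_sol z x - stein_sol z y| <= 2 * `|x - y|.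
  move=> xz yz; have [c _ ->] := MVT_stein_sol_left xz yz.
  by rewrite normrM ler_wpM2r// (stein_slope_le z c true).
have lip_right x y : z <= x -> z <= y ->
    `|stein_sol z x - stein_sol z y| <= 2 * `|x - y|.
  move=> zx zy; have [c _ ->] := MVT_stein_sol_right zx zy.
  by rewrite normrM ler_wpM2r// -[- gauss_cdf z]add0r (stein_slope_le z c false).
wlog wv : w v / w <= v => [h|].
  have [/h//|/ltW/h] := leP w v.
  by rewrite distrC (distrC v).
have [vz|/ltW zv] := leP v z; first by rewrite lip_left// (le_trans wv).
have [wz|/ltW zw] := leP w z; last by rewrite lip_right.
rewrite -(subrKA (stein_sol z z)) (le_trans (ler_normD _ _))//.
rewrite (le_trans (lerD (lip_left _ _ wz (lexx z)) (lip_right _ _ (lexx z) zv)))//.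
rewrite [X in _ * X + _]distrC ger0_norm ?subr_ge0//.
rewrite [`|z - v|]distrC ger0_norm ?subr_ge0//.
by rewrite [`|w - v|]distrC ger0_norm ?subr_ge0//; lra.
Qed.

(** First-order expansion of the Stein solution around the endpoint [w]. If [z] is
    not within reach, the slopes at two points differ by the increment of
    [w * stein_sol z w], which makes the error quadratic; otherwise the jump of
    the derivative leaves an error of first order. *)
Lemma stein_sol_expansion z w v :
  `|stein_sol z w - stein_sol z v - (w - v) * stein_deriv z w| <=
  (stein_bound + 2) * ((w - v) ^+ 2 * (1 + `|v|) +
                       `|w - v| * (`|w - z| <= `|w - v|)%R%:R).
Proof.
have B2 := stein_bound_ge2.
have v0 : 0 <= `|v| by [].
set D := `|w - v|; have D0 : 0 <= D by exact: normr_ge0.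
have D2 : (w - v) ^+ 2 = D ^+ 2 by rewrite /D real_normK ?num_real.
have [zD|Dz] := boolP (`|w - z| <= D).
  rewrite mulr1 (le_trans (ler_normB _ _))//.
  have := stein_sol_lipschitz z w v; rewrite -/D => h1.
  have : `|(w - v) * stein_deriv z w| <= D * 2.
    by rewrite normrM ler_wpM2l// normr_stein_deriv.
  have : 0 <= (w - v) ^+ 2 * (1 + `|v|) by rewrite mulr_ge0 ?sqr_ge0// addr_ge0.
  set q := _ * (1 + _).
  nra.
rewrite mulr0 addr0 -ltNge in Dz *.
suff [c cw ->] : exists2 c, `|c - w| <= D &
    stein_sol z w - stein_sol z v - (w - v) * stein_deriv z w =
    (c * stein_sol z c - w * stein_sol z w) * (w - v).
  rewrite normrM -/D.
  have h1 : `|c * stein_sol z c - w * stein_sol z w| <= 2.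
    rewrite (le_trans (ler_normB _ _))//.
    by have := normr_mul_stein_sol z c; have := normr_mul_stein_sol z w; lra.
  have h2 : `|c * stein_sol z c - w * stein_sol z w| <=
      D * stein_bound + `|w| * (2 * D).
    rewrite (_ : _ - _ = (c - w) * stein_sol z c +
        w * (stein_sol z c - stein_sol z w)); last ring.
    rewrite (le_trans (ler_normD _ _))// (normrM (c - w)) (normrM w) lerD//.
      by apply: ler_pM => //; exact: normr_stein_sol.
    rewrite ler_wpM2l// (le_trans (stein_sol_lipschitz _ _ _))//.
    by rewrite ler_pM2l.
  rewrite D2; move: h1 h2; set y := `|_ * _ - _| => h1 h2.
  have y0 : 0 <= y by rewrite /y.
  have wv : `|w| <= `|v| + D by have := ler_normD v (w - v); rewrite subrKC.
  have [D1|D1] := leP D 1.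
    have h3 : y <= D * ((stein_bound + 2) * (1 + `|v|)).
      apply: (le_trans h2); rewrite [leLHS](_ : _ = D * (stein_bound + 2 * `|w|)); last ring.
      rewrite ler_wpM2l//.
      have : 0 <= stein_bound * `|v| by rewrite mulr_ge0//; lra.
      lra.
    rewrite expr2 mulrA mulrCA -mulrA.
    rewrite [leRHS](_ : _ = D * (D * ((stein_bound + 2) * (1 + `|v|)))); last ring.
    by rewrite mulrC ler_wpM2l.
  have h3 : y * D <= 2 * D by rewrite ler_wpM2r.
  have h4 : D <= D ^+ 2 by rewrite expr2 ler_peMl// ltW.
  apply: (le_trans h3); rewrite mulrCA.
  have h5 : 2 <= (stein_bound + 2) * (1 + `|v|) by nra.
  by rewrite mulrC ler_pM//; lra.
have side : (w <= z /\ v <= z) \/ (z < w /\ z <= v).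
  have [wz|zw] := leP w z.
    have e : `|w - z| = z - w by rewrite distrC ger0_norm ?subr_ge0.
    left; split=> //; move: Dz; rewrite e.
    by have := ler_norm (v - w); rewrite distrC -/D; lra.
  have e : `|w - z| = w - z by rewrite gtr0_norm ?subr_gt0.
  right; split=> //; move: Dz; rewrite e.
  by have := ler_norm (w - v); rewrite -/D; lra.
case: side => -[wz vz].
  have [c cw e] := MVT_stein_sol_left wz vz.
  by exists c => //; rewrite e /stein_deriv wz /=; ring.
have [c cw e] := MVT_stein_sol_right (ltW wz) vz.
by exists c => //; rewrite e /stein_deriv leNgt wz /=; ring.
Qed.

Lemma stein_solP z w :
  stein_deriv z w - w * stein_sol z w = (w <= z)%R%:R - gauss_cdf z.
Proof. by rewrite /stein_deriv addrAC subrr add0r. Qed.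

End gauss.

(** * Independence and resampling *)

Section boxes.
Context d (T : measurableType d) (R : realType) (n : nat).

Definition box (A : 'I_n -> set T) : set (n.-tuple T) :=
  [set t | forall i, A i (tnth t i)].

Lemma measurable_box A : (forall i, measurable (A i)) -> measurable (box A).
Proof.
move=> mA; rewrite (_ : box A = \bigcap_i ((fun t => tnth t i) @^-1` A i)).
  apply: fin_bigcap_measurable => [|i _]; first exact: finite_finset.
  rewrite -[X in measurable X]setTI.
  exact: measurable_tnth.
by apply/seteqP; split => [t tA i _|t tA i]; exact: tA.
Qed.

(** The boxes are stable under intersection and generate the product
    sigma-algebra. *)
Lemma eq_measure_box (m1 m2 : {measure set (n.-tuple T) -> \bar R}) :
  (m1 setT < +oo)%E ->
  (forall A, (forall i, measurable (A i)) -> m1 (box A) = m2 (box A)) ->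
  forall B, measurable B -> m1 B = m2 B.
Proof.
move=> m1oo m12.
apply: (measure_unique [set B | exists2 A, (forall i, measurable (A i)) & B = box A]
  (fun=> setT)) => //.
- rewrite eqEsubset; split.
  + apply: smallest_sub; first exact: smallest_sigma_algebra.
    move=> B; rewrite -bigcup_seq => -[i _ [C mC <-]].
    apply: sub_sigma_algebra => /=.
    exists (fun j => if j == i then C else setT).
      by move=> j; case: ifP.
    rewrite setTI; apply/seteqP; split => [t /= Ct j|t /= /(_ i)].
      by case: eqP => [->|].
    by rewrite eqxx.
  + apply: smallest_sub; first exact: sigma_algebra_measurable.
    by move=> _ [A mA ->]; exact: measurable_box.
- move=> _ _ [A mA ->] [B mB ->]; exists (fun i => A i `&` B i).
    by move=> i; exact: measurableI.
  apply/seteqP; split => [t [tA tB] i|t tAB]; first by split.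
  by split=> i; have [] := tAB i.
- by move=> _; exists (fun=> setT) => //; apply/seteqP; split.
- by rewrite bigcup_const.
- by move=> _ [A mA ->]; exact: m12.
Qed.

End boxes.

Lemma prode_split (R : realType) n (a b : 'I_n -> \bar R) :
  (\prod_(i < n) (a i * b i) = \prod_(i < n) a i * \prod_(i < n) b i)%E.
Proof.
apply: (big_ind3 (fun z x y => z = x * y)%E) => [|x x' y y' z z' -> ->|//].
  by rewrite mule1.
by rewrite muleACA.
Qed.

Section resampling.
Context d (T : measurableType d) (R : realType).
Context dO (Omega : measurableType dO) (Pr : probability Omega R) (n : nat).
Variable X : 'I_n -> Omega -> T.

Definition joint w : n.-tuple T := [tuple X i w | i < n].

(** The factorization over a subfamily is the case where the other sets [A i] are
    full. *)
Definition independent := forall A : 'I_n -> set T,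
  (forall i, measurable (A i)) ->
  Pr [set w | forall i, A i (X i w)] = (\prod_(i < n) Pr (X i @^-1` A i))%E.

Definition mix (J : {pred 'I_n}) (s t : n.-tuple T) : n.-tuple T :=
  [tuple if i \in J then tnth s i else tnth t i | i < n].

Hypothesis mX : forall i, measurable_fun setT (X i).
Hypothesis indX : independent.

Lemma measurable_joint : measurable_fun setT joint.
Proof.
apply/measurable_fun_tnthP => i.
rewrite (_ : _ \o _ = X i)//; apply/funext => w /=.
by rewrite tnth_mktuple.
Qed.

Lemma measurable_mix J dA (A : measurableType dA) (f g : A -> n.-tuple T) :
  measurable_fun setT f -> measurable_fun setT g ->
  measurable_fun setT (fun w => mix J (f w) (g w)).
Proof.
move=> mf mg; apply/measurable_fun_tnthP => i.
have [iJ|iJ] := boolP (i \in J).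
  rewrite (_ : _ \o _ = (@tnth _ _ ^~ i) \o f).
    by apply: measurableT_comp => //; exact: measurable_tnth.
  by apply/funext => w /=; rewrite tnth_mktuple iJ.
rewrite (_ : _ \o _ = (@tnth _ _ ^~ i) \o g).
  by apply: measurableT_comp => //; exact: measurable_tnth.
by apply/funext => w /=; rewrite tnth_mktuple (negbTE iJ).
Qed.


Definition resample J (p : Omega * Omega) : n.-tuple T :=
  mix J (joint p.1) (joint p.2).

Lemma measurable_resample J : measurable_fun setT (resample J).
Proof.
by apply: measurable_mix; apply: measurableT_comp => //; exact: measurable_joint.
Qed.

Lemma measurable_preimage_X (i : 'I_n) (A : set T) :
  measurable A -> measurable (X i @^-1` A).
Proof. by move=> mA; rewrite -[X in measurable X]setTI; exact: mX. Qed.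

(** Redrawing the entries outside [J] from an independent copy of the sample does
    not change its law: on boxes, both laws are the product of the marginals.
    Expectations under independence are all computed through this statement. *)
Lemma resampling J (B : set (n.-tuple T)) : measurable B ->
  Pr (joint @^-1` B) = (Pr \x Pr)%E (resample J @^-1` B).
Proof.
pose f : {mfun Omega >-> n.-tuple T} := HB.pack joint
  (isMeasurableFun.Build _ _ _ _ _ measurable_joint).
pose g : {mfun (Omega * Omega)%type >-> n.-tuple T} := HB.pack (resample J)
  (isMeasurableFun.Build _ _ _ _ _ (measurable_resample J)).
apply: (@eq_measure_box _ _ _ _ (pushforward Pr f) (pushforward (Pr \x Pr)%E g)).
  by rewrite -[X in (X < _)%E]/(Pr setT) probability_setT ltry.
move=> A mA; rewrite /pushforward /=.
pose A1 i := if i \in J then A i else setT.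
pose A2 i := if i \in J then setT else A i.
have mA1 i : measurable (A1 i) by rewrite /A1; case: ifP.
have mA2 i : measurable (A2 i) by rewrite /A2; case: ifP.
have E (C : 'I_n -> set T) : [set w | forall i, C i (X i w)] = joint @^-1` box C.
  by apply/seteqP; split => w /= h i; have := h i; rewrite tnth_mktuple.
have mE C : (forall i, measurable (C i)) -> measurable (joint @^-1` box C).
  move=> mC; rewrite -[X in measurable X]setTI; apply: measurable_joint => //.
  exact: measurable_box.
have gE : resample J @^-1` box A = (joint @^-1` box A1) `*` (joint @^-1` box A2).
  apply/seteqP; split => -[w v] /=.
    move=> h; split=> /= i; have := h i; rewrite /resample !tnth_mktuple/= /A1 /A2;
      by case: ifP.
  move=> [/= h1 h2] i; have := h1 i; have := h2 i.
  by rewrite /resample !tnth_mktuple/= /A1 /A2; case: ifP.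
transitivity ((Pr \x Pr)%E ((joint @^-1` box A1) `*` (joint @^-1` box A2)));
  last by rewrite -gE.
transitivity (Pr (joint @^-1` box A)) => //.
have indJ C : (forall i, measurable (C i)) ->
    Pr (joint @^-1` box C) = (\prod_(i < n) Pr (X i @^-1` C i))%E.
  by move=> mC; rewrite -E; exact: indX.
rewrite product_measure1E; [|exact: mE|exact: mE].
rewrite !indJ//.
have S := prode_split (fun i => Pr (X i @^-1` A1 i)) (fun i => Pr (X i @^-1` A2 i)).
have S1 : (Pr (joint @^-1` box A1) * Pr (joint @^-1` box A2))%E =
    (\prod_(i < n) (Pr (X i @^-1` A1 i) * Pr (X i @^-1` A2 i)))%E.
  by rewrite (indJ _ mA1) (indJ _ mA2) S.
apply: (eq_trans _ (esym S1)).
apply: eq_bigr => i _; rewrite /A1 /A2; case: ifP => _.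
  by rewrite preimage_setT probability_setT mule1.
by rewrite preimage_setT probability_setT mul1e.
Qed.

Lemma ge0_integral_resampling (J : {pred 'I_n}) (H : n.-tuple T -> \bar R) :
  measurable_fun [set: n.-tuple T] H -> (forall t, 0 <= H t)%E ->
  (\int[Pr]_w H (joint w) = \int[Pr]_w \int[Pr]_v H (mix J (joint w) (joint v)))%E.
Proof.
move=> mH H0.
pose f : {mfun Omega >-> n.-tuple T} := HB.pack joint
  (isMeasurableFun.Build _ _ _ _ _ measurable_joint).
pose g : {mfun (Omega * Omega)%type >-> n.-tuple T} := HB.pack (resample J)
  (isMeasurableFun.Build _ _ _ _ _ (measurable_resample J)).
have mg := measurable_resample J.
transitivity (\int[pushforward Pr f]_t H t)%E.
  by rewrite ge0_integral_pushforward//=; exact: measurable_joint.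
transitivity (\int[pushforward (Pr \x Pr)%E g]_t H t)%E.
  apply: eq_measure_integral => B mB _; rewrite /pushforward /=.
  exact: resampling.
rewrite ge0_integral_pushforward//= preimage_setT.
rewrite (fubini_tonelli1 (H \o resample J))//=.
exact: measurableT_comp.
Qed.

End resampling.

(** * Expectations of real random variables *)

Section expectation.
Context d (T : measurableType d) (R : realType) (P : probability T R).
Implicit Types f g : T -> R.

Definition L1 f : Prop := P.-integrable setT (EFin \o f).
Definition Ex f : R := \int[P]_w f w.

Lemma L1_measurable f : L1 f -> measurable_fun setT f.
Proof. by move=> /integrableP[/measurable_EFinP]. Qed.

Lemma L1_cst (c : R) : L1 (fun=> c).
Proof. exact: finite_measure_integrable_cst. Qed.

Lemma L1_eq f g : f =1 g -> L1 f -> L1 g.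
Proof. by move=> /funext ->. Qed.

Lemma L1D f g : L1 f -> L1 g -> L1 (fun w => f w + g w).
Proof. by move=> Lf Lg; exact: (integrableD measurableT Lf Lg). Qed.

Lemma L1B f g : L1 f -> L1 g -> L1 (fun w => f w - g w).
Proof. by move=> Lf Lg; exact: (integrableB measurableT Lf Lg). Qed.

Lemma L1Zl c f : L1 f -> L1 (fun w => c * f w).
Proof. by move=> Lf; exact: (integrableZl measurableT c Lf). Qed.

Lemma L1Zr c f : L1 f -> L1 (fun w => f w * c).
Proof. by move/(L1Zl c); apply: L1_eq => w; rewrite mulrC. Qed.

Lemma L1_norm f : L1 f -> L1 (fun w => `|f w|).
Proof. by move=> Lf; exact: (integrable_norm Lf). Qed.

Lemma L1_sum (I : Type) (s : seq I) (h : I -> T -> R) :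
  (forall i, L1 (h i)) -> L1 (fun w => \sum_(i <- s) h i w).
Proof.
move=> Lh; elim: s => [|i s ih].
  by apply: L1_eq (L1_cst 0) => w; rewrite big_nil.
by apply: L1_eq (L1D (Lh i) ih) => w; rewrite big_cons.
Qed.

Lemma L1_le g f : measurable_fun setT f -> L1 g ->
  (forall w, `|f w| <= g w) -> L1 f.
Proof.
move=> mf Lg fg; apply: (le_integrable _ _ _ Lg) => //.
  exact/measurable_EFinP.
move=> w _ /=; rewrite lee_fin (le_trans (fg w))//.
exact: ler_norm.
Qed.

Lemma L1_bounded c f : measurable_fun setT f -> (forall w, `|f w| <= c) -> L1 f.
Proof. by move=> mf fc; exact: (L1_le mf (L1_cst c)). Qed.

Lemma Ex_EFin f : L1 f -> (\int[P]_w (f w)%:E)%E = (Ex f)%:E.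
Proof. by move=> Lf; rewrite /Ex /Rintegral fineK//; exact: integrable_fin_num. Qed.

Lemma Ex_cst (c : R) : Ex (fun=> c) = c.
Proof. by rewrite /Ex Rintegral_cst//= probability_setT mulr1. Qed.

Lemma eq_Ex f g : f =1 g -> Ex f = Ex g.
Proof. by move=> /funext ->. Qed.

Lemma ExD f g : L1 f -> L1 g -> Ex (fun w => f w + g w) = Ex f + Ex g.
Proof. exact: RintegralD. Qed.

Lemma ExB f g : L1 f -> L1 g -> Ex (fun w => f w - g w) = Ex f - Ex g.
Proof. exact: RintegralB. Qed.

Lemma ExZl c f : L1 f -> Ex (fun w => c * f w) = c * Ex f.
Proof. by move=> Lf; exact: RintegralZl. Qed.

Lemma ExZr c f : L1 f -> Ex (fun w => f w * c) = Ex f * c.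
Proof. by move=> Lf; exact: RintegralZr. Qed.

Lemma Ex_sum (I : Type) (s : seq I) (h : I -> T -> R) :
  (forall i, L1 (h i)) ->
  Ex (fun w => \sum_(i <- s) h i w) = \sum_(i <- s) Ex (h i).
Proof.
move=> Lh; elim: s => [|i s ih].
  rewrite big_nil -[RHS](Ex_cst 0).
  by apply: eq_Ex => w; rewrite big_nil.
rewrite big_cons -ih -ExD//; last exact: L1_sum.
by apply: eq_Ex => w; rewrite big_cons.
Qed.

Lemma Ex_ge0 f : (forall w, 0 <= f w) -> 0 <= Ex f.
Proof. by move=> f0; exact: Rintegral_ge0. Qed.

Lemma Ex_le f g : L1 f -> L1 g -> (forall w, f w <= g w) -> Ex f <= Ex g.
Proof. by move=> Lf Lg fg; exact: le_Rintegral. Qed.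

Lemma Ex_norm f : L1 f -> `|Ex f| <= Ex (fun w => `|f w|).
Proof. by move=> Lf; exact: le_normr_Rintegral. Qed.

Lemma Ex_norm_le f g : L1 f -> L1 g -> (forall w, `|f w| <= g w) ->
  `|Ex f| <= Ex g.
Proof.
move=> Lf Lg fg; apply: (le_trans (Ex_norm Lf)).
by apply: Ex_le => //; exact: L1_norm.
Qed.

Lemma measurable_natr_bool (e : T -> bool) : measurable_fun setT e ->
  measurable_fun setT (fun w => (e w)%:R : R).
Proof.
move=> me.
by apply: (@measurableT_comp _ _ _ _ _ _ (fun b : bool => b%:R : R) _ e).
Qed.

Lemma L1_bool (e : T -> bool) : measurable_fun setT e ->
  L1 (fun w => (e w)%:R : R).
Proof.
move=> me; apply: (@L1_bounded 1); first exact: measurable_natr_bool.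
by move=> w; case: (e w); rewrite ?normr0 ?normr1.
Qed.

Lemma prob_Ex (e : T -> bool) : measurable_fun setT e ->
  P [set w | e w] = (Ex (fun w => (e w)%:R))%:E.
Proof.
move=> me; rewrite -Ex_EFin; last exact: L1_bool.
have mA : measurable [set w | e w].
  by have := me measurableT [set true] I; rewrite setTI.
rewrite -(setIT [set w | e w]) -(integral_indic P measurableT mA).
apply: eq_integral => w _; rewrite indicE; congr (_%:R%:E).
have [ew|/negP ew] := boolP (e w).
  by rewrite mem_set.
by rewrite memNset.
Qed.

Lemma Ex_bool_le1 (e : T -> bool) : measurable_fun setT e ->
  Ex (fun w => (e w)%:R : R) <= 1.
Proof.
move=> me; rewrite -[leRHS]Ex_cst; apply: Ex_le; first exact: L1_bool.
  exact: L1_cst.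
by move=> w; case: (e w).
Qed.

Lemma L1_ge0_lty f : measurable_fun setT f -> (forall w, 0 <= f w) ->
  (\int[P]_w (f w)%:E < +oo)%E -> L1 f.
Proof.
move=> mf f0 foo; apply/integrableP; split; first exact/measurable_EFinP.
by under eq_integral do rewrite /= ger0_norm//.
Qed.

Lemma L1_ge0_le f (b : R) : measurable_fun setT f -> (forall w, 0 <= f w) ->
  (\int[P]_w (f w)%:E <= b%:E)%E -> L1 f /\ Ex f <= b.
Proof.
move=> mf f0 fb; have Lf : L1 f.
  by apply: L1_ge0_lty => //; rewrite (le_lt_trans fb)// ltry.
by split => //; rewrite -lee_fin -Ex_EFin.
Qed.

End expectation.

(** * Conditioning on one coordinate *)

Section real_family.
Context (R : realType) dO (Omega : measurableType dO) (Pr : probability Omega R).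
Context (n : nat) (X : 'I_n -> Omega -> R).
Hypothesis mX : forall i, measurable_fun setT (X i).
Hypothesis indX : independent Pr X.

Local Notation L1 := (L1 Pr).
Local Notation E := (Ex Pr).

Definition put (i : 'I_n) (x : R) (t : n.-tuple R) : n.-tuple R :=
  [tuple if k == i then x else tnth t k | k < n].

Lemma tnth_put i x t k : tnth (put i x t) k = if k == i then x else tnth t k.
Proof. by rewrite tnth_mktuple. Qed.

Lemma put_put i x y t : put i x (put i y t) = put i x t.
Proof.
by apply: eq_from_tnth => k; rewrite !tnth_put; case: eqP.
Qed.

Lemma measurable_put i dA (A : measurableType dA) (f : A -> R) (g : A -> n.-tuple R) :
  measurable_fun setT f -> measurable_fun setT g ->
  measurable_fun setT (fun w => put i (f w) (g w)).
Proof.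
move=> mf mg; apply/measurable_fun_tnthP => k.
have [ki|ki] := eqVneq k i.
  rewrite (_ : _ \o _ = f)//.
  by apply/funext => w /=; rewrite tnth_put ki eqxx.
rewrite (_ : _ \o _ = (@tnth _ _ ^~ k) \o g).
  by apply: measurableT_comp => //; exact: measurable_tnth.
by apply/funext => w /=; rewrite tnth_put (negbTE ki).
Qed.

Lemma mix_pred1 i s t : mix (pred1 i) s t = put i (tnth s i) t.
Proof.
apply: eq_from_tnth => k; rewrite !tnth_mktuple inE.
by case: eqP => [->|].
Qed.

Let mJ := measurable_joint mX.

Lemma tnth_joint i w : tnth (joint X w) i = X i w.
Proof. by rewrite tnth_mktuple. Qed.

Lemma ge0_integral_put i (H : n.-tuple R -> \bar R) :
  measurable_fun setT H -> (forall t, 0 <= H t)%E ->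
  (\int[Pr]_w H (joint X w) =
   \int[Pr]_w \int[Pr]_v H (put i (X i w) (joint X v)))%E.
Proof.
move=> mH H0; apply: etrans (ge0_integral_resampling mX indX (pred1 i) mH H0) _.
apply: eq_integral => w _; apply: eq_integral => v _.
by rewrite mix_pred1 tnth_joint.
Qed.

Lemma measurable_joint_put i (H : n.-tuple R -> R) x : measurable_fun setT H ->
  measurable_fun setT (fun v => H (put i x (joint X v))).
Proof.
by move=> mH; apply: (measurableT_comp mH); exact: measurable_put.
Qed.

(** Conditioning on [X i]: a bound on the expectation for every frozen value of
    the [i]-th entry may be integrated. *)
Lemma Ex_le_conditional i (H : n.-tuple R -> R) (b : R -> R) :
  measurable_fun setT H -> (forall t, 0 <= H t) ->
  (forall x, L1 (fun v => H (put i x (joint X v))) /\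
             E (fun v => H (put i x (joint X v))) <= b x) ->
  L1 (fun w => b (X i w)) ->
  L1 (fun w => H (joint X w)) /\ E (fun w => H (joint X w)) <= E (fun w => b (X i w)).
Proof.
move=> mH H0 Hb Lb; apply: L1_ge0_le => //; first exact: measurableT_comp.
have me : measurable_fun setT (EFin \o H) by exact/measurable_EFinP.
have He t : (0 <= (EFin \o H) t)%E by rewrite lee_fin.
rewrite (ge0_integral_put i me He).
rewrite -Ex_EFin//; apply: ge0_le_integral => //.
- by move=> w _; apply: integral_ge0 => v _; rewrite lee_fin.
- have mF : measurable_fun setT
      (fun p : Omega * Omega => (H (put i (X i p.1) (joint X p.2)))%:E).
    apply/measurable_EFinP; apply: (measurableT_comp mH); apply: measurable_put.
      exact: measurableT_comp.
    exact: measurableT_comp.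
  have F0 (p : Omega * Omega) :
      (0 <= (H (put i (X i p.1) (joint X p.2)))%:E)%E by rewrite lee_fin.
  exact: (@measurable_fun_fubini_tonelli_F _ _ _ _ _ Pr _ mF F0).
- exact/measurable_EFinP/(L1_measurable Lb).
- move=> w _ /=; have [L le] := Hb (X i w).
  by move: le; rewrite -lee_fin -Ex_EFin.
Qed.

(** Setting the [i]-th entry to [0] is the way to say that [G] depends on the other
    entries only; the factorization is Fubini's theorem after resampling. *)
Lemma Ex_independent i (psi : R -> R) (G : n.-tuple R -> R) :
  measurable_fun setT psi -> measurable_fun setT G ->
  L1 (fun w => psi (X i w)) -> L1 (fun w => G (put i 0 (joint X w))) ->
  L1 (fun w => psi (X i w) * G (put i 0 (joint X w))) /\
  E (fun w => psi (X i w) * G (put i 0 (joint X w))) =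
    E (fun w => psi (X i w)) * E (fun w => G (put i 0 (joint X w))).
Proof.
move=> mpsi mG Lpsi LG.
pose H (t : n.-tuple R) := psi (tnth t i) * G (put i 0 t).
have mput0 : measurable_fun [set: n.-tuple R] (put i 0).
  exact: (@measurable_put i _ _ (fun=> 0) (fun t => t)).
have mGput : measurable_fun setT (G \o put i 0) by exact: measurableT_comp.
have mH : measurable_fun setT H.
  apply: measurable_funM => //; apply: measurableT_comp => //.
  exact: measurable_tnth.
have HE x w : H (put i x (joint X w)) = psi x * G (put i 0 (joint X w)).
  by rewrite /H tnth_put eqxx put_put.
pose g (p : Omega * Omega) := resample X (pred1 i) p.
have mg : measurable_fun setT g by exact: measurable_resample.
have gE p : g p = put i (X i p.1) (joint X p.2).
  by rewrite /g /resample mix_pred1 tnth_joint.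
have mHg : measurable_fun setT (EFin \o H \o g).
  by apply/measurable_EFinP; exact: measurableT_comp.
have mEH : measurable_fun setT (EFin \o H) by exact/measurable_EFinP.
have mHJ : measurable_fun setT (EFin \o H \o joint X).
  by apply/measurable_EFinP; exact: measurableT_comp.
have int_prod : ((Pr \x Pr)%E).-integrable setT (EFin \o H \o g).
  apply/integrable12ltyP => //.
  have -> : (\int[Pr]_x \int[Pr]_y `|(EFin \o H \o g) (x, y)|)%E =
      (\int[Pr]_x (`|psi (X i x)|%:E * (E (fun w => `|G (put i 0 (joint X w))|))%:E))%E.
    apply: eq_integral => x _; rewrite -Ex_EFin; last exact: L1_norm.
    rewrite -ge0_integralZl//.
    + by apply: eq_integral => y _; rewrite /= gE HE normrM.
    + exact/measurable_EFinP/(L1_measurable (L1_norm LG)).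
  under eq_integral do rewrite -EFinM.
  by rewrite Ex_EFin ?ltry//; apply: L1Zr; exact: L1_norm.
have int_joint : Pr.-integrable setT (EFin \o H \o joint X).
  apply/integrableP; split=> //.
  have := ge0_integral_put i (H := fun t => (`|H t|)%:E).
  move=> -> //; last first.
    by apply/measurable_EFinP; exact: measurableT_comp.
  move/integrable12ltyP : int_prod => /(_ mHg).
  by under eq_integral do under eq_integral do rewrite /= gE.
have eqs : (\int[Pr]_w (EFin \o H \o joint X) w =
    \int[(Pr \x Pr)%E]_p (EFin \o H \o g) p)%E.
  pose f1 : {mfun Omega >-> n.-tuple R} := HB.pack (joint X)
    (isMeasurableFun.Build _ _ _ _ _ mJ).
  pose g1 : {mfun (Omega * Omega)%type >-> n.-tuple R} := HB.pack g
    (isMeasurableFun.Build _ _ _ _ _ mg).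
  transitivity (\int[pushforward Pr f1]_t (EFin \o H) t)%E.
    exact: (esym (integral_pushforward mJ mEH int_joint measurableT)).
  transitivity (\int[pushforward (Pr \x Pr)%E g1]_t (EFin \o H) t)%E.
    apply: eq_measure_integral => B mB _; rewrite /pushforward /=.
    exact: resampling.
  exact: (integral_pushforward mg mEH int_prod measurableT).
have LH : L1 (fun w => H (joint X w)) by exact: int_joint.
have HJ w : H (joint X w) = psi (X i w) * G (put i 0 (joint X w)).
  by rewrite /H tnth_joint.
split; first exact: L1_eq HJ LH.
apply: EFin_inj; rewrite -(eq_Ex _ HJ) -Ex_EFin//.
rewrite [LHS]eqs -integral12_prod_meas1// EFinM.
rewrite -[in RHS]Ex_EFin// -integralZr//.
apply: eq_integral => w _; rewrite -Ex_EFin// -integralZl//.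
by apply: eq_integral => v _; rewrite /= gE HE.
Qed.

End real_family.

(** * Sums of independent variables and of their squares *)

Section statistics.
Context (R : realType) (n : nat).
Implicit Types t : n.-tuple R.

Definition lin_sum t : R := \sum_(k < n) tnth t k.
Definition sqr_sum t : R := \sum_(k < n) tnth t k ^+ 2.

Lemma measurable_lin_sum : measurable_fun setT lin_sum.
Proof. by apply: measurable_sum => k; exact: measurable_tnth. Qed.

Lemma measurable_sqr_sum : measurable_fun setT sqr_sum.
Proof.
apply: measurable_sum => k; apply: measurable_funX; exact: measurable_tnth.
Qed.

Lemma lin_sum_put i x t : lin_sum (put i x t) = lin_sum (put i 0 t) + x.
Proof.
rewrite /lin_sum (bigD1 i)//= [in RHS](bigD1 i)//= !tnth_put eqxx add0r addrC.
by congr (_ + _); apply: eq_bigr => k ki; rewrite !tnth_put (negbTE ki).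
Qed.

Lemma sqr_sum_put i x t : sqr_sum (put i x t) = sqr_sum (put i 0 t) + x ^+ 2.
Proof.
rewrite /sqr_sum (bigD1 i)//= [in RHS](bigD1 i)//= !tnth_put eqxx expr0n add0r addrC.
by congr (_ + _); apply: eq_bigr => k ki; rewrite !tnth_put (negbTE ki).
Qed.

Lemma put_tnth i t : put i (tnth t i) t = t.
Proof. by apply: eq_from_tnth => k; rewrite tnth_put; case: eqP => [->|]. Qed.

Lemma lin_sum_split i t : lin_sum t = lin_sum (put i 0 t) + tnth t i.
Proof. by rewrite -lin_sum_put put_tnth. Qed.

Lemma sqr_sum_split i t : sqr_sum t = sqr_sum (put i 0 t) + tnth t i ^+ 2.
Proof. by rewrite -sqr_sum_put put_tnth. Qed.

Lemma sqr_sum_ge0 t : 0 <= sqr_sum t.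
Proof. by apply: sumr_ge0 => k _; exact: sqr_ge0. Qed.

End statistics.

Section moments.
Context (R : realType) dO (Omega : measurableType dO) (Pr : probability Omega R).
Context (n : nat) (X : 'I_n -> Omega -> R).
Hypothesis mX : forall i, measurable_fun setT (X i).
Hypothesis indX : independent Pr X.
Hypothesis X3 : forall i, L1 Pr (fun w => `|X i w| ^+ 3).

Local Notation L1 := (L1 Pr).
Local Notation E := (Ex Pr).
Local Notation J := (joint X).

Let mJ := measurable_joint mX.

Lemma normr_le_1cube (x : R) : `|x| <= 1 + `|x| ^+ 3.
Proof.
have y3 : 0 <= `|x| ^+ 3 by rewrite exprn_ge0.
have [y1|/ltW y1] := leP `|x| 1; first by rewrite (le_trans y1)// lerDl.
by rewrite (le_trans (ler_eXnr _ y1 : _ <= `|x| ^+ 3))// lerDr.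
Qed.

Lemma sqr_le_1cube (x : R) : x ^+ 2 <= 1 + `|x| ^+ 3.
Proof.
rewrite -real_normK ?num_real//.
have y3 : 0 <= `|x| ^+ 3 by rewrite exprn_ge0.
have [y1|/ltW y1] := leP `|x| 1.
  by rewrite (le_trans (exprn_ile1 _ _ y1))// lerDl.
by rewrite (le_trans (ler_weXn2l y1 (isT : (2 <= 3)%N)))// lerDr.
Qed.

Lemma L1_X i : L1 (X i).
Proof.
apply: (L1_le (mX i) (L1D (L1_cst _ 1) (X3 i))) => w; exact: normr_le_1cube.
Qed.

Lemma L1_X2 i : L1 (fun w => X i w ^+ 2).
Proof.
apply: (L1_le _ (L1D (L1_cst _ 1) (X3 i))) => [|w].
  exact: measurable_funX.
by rewrite ger0_norm ?sqr_ge0//; exact: sqr_le_1cube.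
Qed.

Lemma L1_absX i : L1 (fun w => `|X i w|).
Proof. exact: L1_norm (L1_X i). Qed.

(** Chebyshev's association inequality for the increasing functions [|x|] and
    [x ^+ 2] of [|x|], in the only form needed. *)
Lemma abs_mul_sqr_moment i :
  E (fun w => `|X i w|) * E (fun w => X i w ^+ 2) <= E (fun w => `|X i w| ^+ 3).
Proof.
set a := E (fun w => `|X i w|); set v := E (fun w => _ ^+ 2); set tau := E _.
have a0 : 0 <= a by apply: Ex_ge0.
(* tangent line of the cube at [a] *)
have h1 : a ^+ 3 <= tau.
  have -> : a ^+ 3 = E (fun w => 3 * a ^+ 2 * `|X i w| - 2 * a ^+ 3).
    rewrite ExB; [|exact/L1Zl/L1_absX|exact: L1_cst].
    rewrite ExZl; last exact: L1_absX.
    by rewrite Ex_cst -/a; ring.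
  apply: Ex_le; [|exact: X3|].
    by apply: L1B; [exact/L1Zl/L1_absX|exact: L1_cst].
  move=> w; have := normr_ge0 (X i w); set y := `|X i w| => y0.
  have : 0 <= (y - a) ^+ 2 * (y + 2 * a) by rewrite mulr_ge0 ?sqr_ge0//; lra.
  lra.
(* Young's inequality with exponents [3/2] and [3] *)
have h2 : 3 * (a * v) <= 2 * tau + a ^+ 3.
  have -> : 3 * (a * v) = E (fun w => 3 * a * X i w ^+ 2).
    by rewrite ExZl ?mulrA//; exact: L1_X2.
  have -> : 2 * tau + a ^+ 3 = E (fun w => 2 * `|X i w| ^+ 3 + a ^+ 3).
    rewrite ExD; [|exact/L1Zl/X3|exact: L1_cst].
    by rewrite ExZl ?Ex_cst//; exact: X3.
  apply: Ex_le; [exact/L1Zl/L1_X2| |].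
    by apply: L1D; [exact/L1Zl/X3|exact: L1_cst].
  move=> w; rewrite -[X i w ^+ 2]real_normK ?num_real//.
  have := normr_ge0 (X i w); set y := `|X i w| => y0.
  have : 0 <= (y - a) ^+ 2 * (2 * y + a) by rewrite mulr_ge0 ?sqr_ge0//; lra.
  lra.
lra.
Qed.

(** The cross terms vanish by independence. *)
Lemma Ex_sum_sqr (psi : 'I_n -> R -> R) :
  (forall i, measurable_fun setT (psi i)) ->
  (forall i, L1 (fun w => psi i (X i w) ^+ 2)) ->
  (forall i, E (fun w => psi i (X i w)) = 0) ->
  L1 (fun w => (\sum_(i < n) psi i (X i w)) ^+ 2) /\
  E (fun w => (\sum_(i < n) psi i (X i w)) ^+ 2) =
    \sum_(i < n) E (fun w => psi i (X i w) ^+ 2).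
Proof.
move=> mpsi L2 psi0.
have mp i : measurable_fun setT (fun w => psi i (X i w)) by exact: measurableT_comp.
have Lp i : L1 (fun w => psi i (X i w)).
  apply: (L1_le (mp i) (L1D (L1_cst _ 1) (L2 i))) => w.
  rewrite -[psi i (X i w) ^+ 2]real_normK ?num_real//.
  have := normr_ge0 (psi i (X i w)); set y := `|_| => y0; nra.
have Lij i j : L1 (fun w => psi i (X i w) * psi j (X j w)).
  apply: (L1_le _ (L1D (L2 i) (L2 j))) => [|w]; first exact: measurable_funM.
  rewrite normrM -[psi i (X i w) ^+ 2]real_normK ?num_real//.
  rewrite -[psi j (X j w) ^+ 2]real_normK ?num_real//.
  have := normr_ge0 (psi i (X i w)); have := normr_ge0 (psi j (X j w)).
  set y := `|_|; set z := `|_| => y0 z0; nra.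
have sq w : (\sum_(i < n) psi i (X i w)) ^+ 2 =
    \sum_(i < n) \sum_(j < n) psi i (X i w) * psi j (X j w).
  by rewrite expr2 mulr_suml; apply: eq_bigr => i _; rewrite mulr_sumr.
have Lsum i : L1 (fun w => \sum_(j < n) psi i (X i w) * psi j (X j w)).
  by apply: L1_sum => j; exact: Lij.
split.
  apply: (L1_eq (f := fun w => \sum_(i < n) \sum_(j < n) psi i (X i w) * psi j (X j w))).
    by move=> w; rewrite sq.
  exact: L1_sum.
rewrite (eq_Ex _ sq) Ex_sum//; apply: eq_bigr => i _.
rewrite Ex_sum// (bigD1 i)//= big1 ?addr0; first by apply: eq_Ex => w; rewrite expr2.
move=> j ji.
pose G (t : n.-tuple R) := psi j (tnth t j).
have mG : measurable_fun setT G.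
  by apply: measurableT_comp => //; exact: measurable_tnth.
have GE w : psi j (X j w) = G (put i 0 (J w)).
  by rewrite /G tnth_put (negbTE ji) tnth_joint.
have [_ e] := Ex_independent mX indX (mpsi i) mG (Lp i) (L1_eq GE (Lp j)).
transitivity (E (fun w => psi i (X i w) * G (put i 0 (J w)))).
  by apply: eq_Ex => w; rewrite GE.
by rewrite e psi0 mul0r.
Qed.

(** The basic move of the proof: against a centered function of one variable, a
    statistic counts only through its dependence on that variable. *)
Lemma Ex_leave_one_out i (psi : R -> R) (G : n.-tuple R -> R) (c : R) :
  measurable_fun setT psi -> measurable_fun setT G -> (forall t, `|G t| <= c) ->
  L1 (fun w => psi (X i w)) -> E (fun w => psi (X i w)) = 0 ->
  [/\ L1 (fun w => psi (X i w) * G (J w)),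
      L1 (fun w => psi (X i w) * (G (J w) - G (put i 0 (J w)))) &
      E (fun w => psi (X i w) * G (J w)) =
      E (fun w => psi (X i w) * (G (J w) - G (put i 0 (J w))))].
Proof.
move=> mpsi mG Gc Lp p0.
have mp : measurable_fun setT (fun w => psi (X i w)) by exact: measurableT_comp.
have mGJ : measurable_fun setT (fun w => G (J w)) by exact: measurableT_comp.
have mGi : measurable_fun setT (fun w => G (put i 0 (J w))).
  exact: measurable_joint_put.
have L1G : L1 (fun w => psi (X i w) * G (J w)).
  apply: (L1_le _ (L1Zr c (L1_norm Lp))) => [|w]; first exact: measurable_funM.
  by rewrite normrM ler_wpM2l.
have [L1Gi e] := Ex_independent mX indX mpsi mG Lp (L1_bounded Pr mGi (fun w => Gc _)).
have eB w : psi (X i w) * (G (J w) - G (put i 0 (J w))) =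
    psi (X i w) * G (J w) - psi (X i w) * G (put i 0 (J w)) by rewrite mulrBr.
split=> //.
  exact: L1_eq (fun w => esym (eB w)) (L1B L1G L1Gi).
by rewrite (eq_Ex _ eB) ExB// e p0 mul0r subr0.
Qed.

End moments.

Ltac case_min_max :=
  repeat match goal with
  | |- context [Order.min ?a ?b] => case: (leP a b) => ?
  | |- context [Order.max ?a ?b] => case: (leP a b) => ?
  end.

(** * Truncations and weights *)

Section clip.
Context (R : realType).
Implicit Types a x y : R.

Definition clip a x : R := Num.max (- a) (Num.min a x).

Lemma clip_id a x : `|x| <= a -> clip a x = x.
Proof.
rewrite ler_norml => /andP[? ?]; rewrite /clip.
by case_min_max; lra.
Qed.

Lemma normr_clip a x : 0 <= a -> `|clip a x| <= a.
Proof.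
move=> a0; rewrite ler_norml /clip.
by case_min_max; apply/andP; split; lra.
Qed.

Lemma clip_diff a x y : 0 <= a -> x <= y -> 0 <= clip a y - clip a x <= y - x.
Proof.
move=> a0 xy; rewrite /clip.
by case_min_max; apply/andP; split; lra.
Qed.

Lemma clip_le a x y : 0 <= a -> x <= y -> clip a x <= clip a y.
Proof. by move=> a0 xy; have /andP[] := clip_diff a0 xy; rewrite subr_ge0. Qed.

Lemma clip_lipschitz a x y : 0 <= a -> `|clip a x - clip a y| <= `|x - y|.
Proof.
move=> a0; wlog xy : x y / x <= y => [h|].
  by have [/h//|/ltW/h] := leP x y; rewrite distrC (distrC y).
have /andP[h1 h2] := clip_diff a0 xy.
by rewrite distrC ger0_norm// distrC ger0_norm ?subr_ge0.
Qed.

Lemma measurable_clip a : measurable_fun setT (clip a).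
Proof.
by apply: measurable_maxr => //; apply: measurable_minr.
Qed.

End clip.

Section kernels.
Context (R : realType).
Implicit Types (g : R -> R) (z s u x h : R).

(** The functions [g] for which [s * g u] is studied. They need not be related to
    the inverse square root: the concentration inequality is also applied to
    shifts of it. *)
Definition weight g := [/\ measurable_fun setT g,
  forall u, 2^-1 <= g u <= 2 & forall u v, `|g u - g v| <= 2 * `|u - v|].

Lemma weight_shift g c : weight g -> weight (fun u => g (u + c)).
Proof.
move=> [mg gb gl]; split => //; first by apply: (measurableT_comp mg); exact: measurable_funD.
by move=> u v; rewrite (le_trans (gl _ _))// opprD addrACA subrr addr0.
Qed.

(** Effect of a change of the quadratic sum: Lipschitz, with a constant that grows
    with the linear sum. *)
Lemma weight_lipschitz_mul g (f : R -> R) (B K : R) s u v : weight g ->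
  (forall w, `|f w| <= B) -> (forall w w', `|f w - f w'| <= K * `|w - w'|) ->
  `|g u * f (s * g u) - g v * f (s * g v)| <=
  `|u - v| * (2 * B + 4 * K * `|s|).
Proof.
move=> [_ gb gl] fB fK.
have /andP[gv1 gv2] := gb v.
have K0 : 0 <= K * `|s|.
  have := fK (s + 1) s; rewrite (addrAC s 1) subrr add0r normr1 mulr1 => h.
  by rewrite mulr_ge0// (le_trans _ h).
have -> : g u * f (s * g u) - g v * f (s * g v) =
  (g u - g v) * f (s * g u) + g v * (f (s * g u) - f (s * g v)) by ring.
rewrite (le_trans (ler_normD _ _))// !normrM.
have h1 : `|g u - g v| * `|f (s * g u)| <= 2 * `|u - v| * B.
  by apply: ler_pM.
have h2 : `|f (s * g u) - f (s * g v)| <= K * `|s| * (2 * `|u - v|).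
  have := fK (s * g u) (s * g v); rewrite -mulrBr normrM [leRHS]mulrA => h.
  by apply: (le_trans h); apply: ler_wpM2l; last exact: gl.
have h3 : `|g v| * `|f (s * g u) - f (s * g v)| <= 2 * (K * `|s| * (2 * `|u - v|)).
  by apply: ler_pM => //; rewrite ger0_norm//; lra.
lra.
Qed.

(** A substitute for [x ^+ 2] whose variance is controlled by the second moment of
    [x]. *)
Definition trunc_sqr (c x : R) := `|x| * Num.min `|x| c.

Lemma trunc_sqr_ge0 c x : 0 <= c -> 0 <= trunc_sqr c x.
Proof. by move=> c0; rewrite mulr_ge0// le_min normr_ge0. Qed.

Lemma trunc_sqr_le c x : trunc_sqr c x <= c * `|x|.
Proof. by rewrite /trunc_sqr mulrC ler_wpM2r// ge_min lexx orbT. Qed.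

(** Truncation loses at most [|x| ^+ 3 / (4 * c)]: beyond the level [c], and after
    multiplication by [4 * c], the difference is [|x|] times a perfect square. *)
Lemma trunc_sqr_ge c x : 0 < c ->
  4 * c * x ^+ 2 - `|x| ^+ 3 <= 4 * c * trunc_sqr c x.
Proof.
move=> c0; rewrite /trunc_sqr -[x ^+ 2]real_normK ?num_real//.
have := normr_ge0 x; set y := `|x| => y0.
have : 0 <= y ^+ 3 by rewrite exprn_ge0.
have : 0 <= y * (2 * c - y) ^+ 2 by rewrite mulr_ge0// sqr_ge0.
by case_min_max; lra.
Qed.

Lemma measurable_trunc_sqr c : measurable_fun setT (trunc_sqr c).
Proof.
by apply: measurable_funM => //; apply: measurable_minr.
Qed.

(** The clipped identity has slope one within [c] of the window [|w| <= eta], so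
    that a step [h] starting in the window moves it by at least [min |h| c];
    elsewhere monotonicity gives the sign. *)
Lemma clip_step eta c w h : 0 <= eta -> 0 <= c ->
  (`|w| <= eta)%R%:R * (`|h| * Num.min `|h| c) <=
  h * (clip (eta + c) w - clip (eta + c) (w - h)).
Proof.
move=> eta0 c0; have e0 : 0 <= eta + c by lra.
have hpos : 0 <= h * (clip (eta + c) w - clip (eta + c) (w - h)).
  have [h0|/ltW h0] := leP 0 h.
    by rewrite mulr_ge0// subr_ge0 clip_le//; lra.
  by rewrite mulr_le0// subr_le0 clip_le//; lra.
case: (leP `|w| eta) => [|_]; last by rewrite mul0r.
rewrite ler_norml mul1r => /andP[w1 w2].
have clip_w : clip (eta + c) w = w.
  by apply: clip_id; rewrite ler_norml; apply/andP; split; lra.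
rewrite clip_w; set q := Num.min `|h| c.
have q0 : 0 <= q by rewrite le_min normr_ge0.
have qh : q <= `|h| by rewrite ge_min lexx.
have qc : q <= c by rewrite ge_min lexx orbT.
have [h0|/ltW h0] := leP 0 h.
  rewrite (ger0_norm h0) ler_wpM2l//; rewrite (ger0_norm h0) in qh.
  have : clip (eta + c) (w - h) <= clip (eta + c) (w - q) by rewrite clip_le//; lra.
  rewrite (@clip_id _ _ (w - q)); first by lra.
  by rewrite ler_norml; apply/andP; split; lra.
rewrite (ler0_norm h0) in qh *.
rewrite -[leRHS]mulrNN ler_wpM2l ?oppr_ge0//.
have : clip (eta + c) (w + q) <= clip (eta + c) (w - h) by rewrite clip_le//; lra.
rewrite (@clip_id _ _ (w + q)); first by lra.
by rewrite ler_norml; apply/andP; split; lra.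
Qed.

(** The same for the argument [s * u], the bound [2^-1 <= u] being absorbed in a
    factor [4]. *)
Lemma clip_weight_step eta c z s x u : 0 <= eta -> 0 <= c -> 2^-1 <= u ->
  (`|s * u - z| <= eta)%R%:R * trunc_sqr c x / 4 <=
  x * (u * clip (eta + c) (s * u - z) -
       u * clip (eta + c) ((s - x) * u - z)).
Proof.
move=> eta0 c0 u1.
have := @clip_step eta c (s * u - z) (x * u) eta0 c0.
have -> : s * u - z - x * u = (s - x) * u - z by ring.
rewrite -mulrBr => h; rewrite [leRHS]mulrA; apply: (le_trans _ h).
rewrite -mulrA ler_wpM2l//.
have u0 : 0 <= u by lra.
rewrite normrM (ger0_norm u0) /trunc_sqr.
have := normr_ge0 x; set y := `|x| => y0.
have yu : y / 2 <= y * u by rewrite ler_wpM2l.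
have m0 : 0 <= Num.min y c by rewrite le_min y0.
rewrite [leLHS](_ : _ = y / 2 * (Num.min y c / 2)); last by field.
apply: ler_pM => //; [lra|lra|].
by move: yu {m0}; set yu := y * u; case_min_max; lra.
Qed.

End kernels.

(** * A concentration inequality *)

Section concentration.
Context (R : realType) dO (Omega : measurableType dO) (Pr : probability Omega R).
Context (n : nat) (X : 'I_n -> Omega -> R).
Hypothesis mX : forall i, measurable_fun setT (X i).
Hypothesis indX : independent Pr X.
Hypothesis X3 : forall i, L1 Pr (fun w => `|X i w| ^+ 3).

Local Notation L1 := (L1 Pr).
Local Notation E := (Ex Pr).
Local Notation J := (joint X).

Hypothesis X0 : forall i, E (X i) = 0.
Hypothesis var_le1 : \sum_(i < n) E (fun w => X i w ^+ 2) <= 1.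

Let mJ := measurable_joint mX.

(** First absolute moments are bounded through second moments, by
    [2 * |s| <= 1 + s ^ 2]. *)
Lemma abs_partial_sum (b : pred 'I_n) :
  L1 (fun w => `|\sum_(k < n) (b k)%:R * X k w|) /\
  E (fun w => `|\sum_(k < n) (b k)%:R * X k w|) <= 1.
Proof.
have [|||L2 e2] := @Ex_sum_sqr _ _ _ _ _ _ mX indX
  (fun k (x : R) => (b k)%:R * x).
- by move=> k; exact: measurable_funM.
- move=> k; apply: (L1_eq (f := fun w => (b k)%:R ^+ 2 * X k w ^+ 2)).
    by move=> w; rewrite exprMn.
  exact/L1Zl/L1_X2.
- by move=> k; rewrite ExZl ?X0 ?mulr0//; exact: L1_X.
have L : L1 (fun w => `|\sum_(k < n) (b k)%:R * X k w|).
  by apply/L1_norm/L1_sum => k; exact/L1Zl/L1_X.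
split=> //.
have LB : L1 (fun w => 2^-1 * (1 + (\sum_(k < n) (b k)%:R * X k w) ^+ 2)).
  by apply: L1Zl; apply: L1D => //; exact: L1_cst.
apply: (@le_trans _ _ (E (fun w => 2^-1 * (1 + (\sum_(k < n) (b k)%:R * X k w) ^+ 2)))).
  apply: Ex_le => // w; set s := \sum_(k < n) _.
  rewrite -[s ^+ 2]real_normK ?num_real//.
  by have := sqr_ge0 (`|s| - 1); lra.
rewrite ExZl; last by apply: L1D => //; exact: L1_cst.
rewrite ExD//; last exact: L1_cst.
rewrite Ex_cst e2.
suff : \sum_(i < n) E (fun w => ((b i)%:R * X i w) ^+ 2) <= 1 by lra.
apply: le_trans var_le1; apply: ler_sum => i _; apply: Ex_le.
- apply: (L1_eq (f := fun w => (b i)%:R ^+ 2 * X i w ^+ 2)).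
    by move=> w; rewrite exprMn.
  exact/L1Zl/L1_X2.
- exact: L1_X2.
- by move=> w; case: (b i); rewrite ?mul1r// mul0r expr0n sqr_ge0.
Qed.

Lemma lin_sum_J w : lin_sum (J w) = \sum_(k < n) (xpredT k)%:R * X k w.
Proof. by apply: eq_bigr => k _; rewrite tnth_joint mul1r. Qed.

Lemma lin_sum_put0_J i w :
  lin_sum (put i 0 (J w)) = \sum_(k < n) (predC1 i k)%:R * X k w.
Proof.
apply: eq_bigr => k _; rewrite tnth_put tnth_joint /=.
by case: eqP; rewrite ?mul0r ?mul1r.
Qed.

Lemma abs_lin_sum : L1 (fun w => `|lin_sum (J w)|) /\
  E (fun w => `|lin_sum (J w)|) <= 1.
Proof.
have [L e] := abs_partial_sum xpredT; split.
  by apply: L1_eq L => w; rewrite lin_sum_J.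
by under eq_Ex do rewrite lin_sum_J.
Qed.

Lemma abs_lin_sum_put0 i : L1 (fun w => `|lin_sum (put i 0 (J w))|) /\
  E (fun w => `|lin_sum (put i 0 (J w))|) <= 1.
Proof.
have [L e] := abs_partial_sum (predC1 i); split.
  by apply: L1_eq L => w; rewrite lin_sum_put0_J.
by under eq_Ex do rewrite lin_sum_put0_J.
Qed.

(** The sum without its [i]-th term is independent of [X i] and has first absolute
    moment at most [1]. *)
Lemma cube_mul_leave_one_out i :
  L1 (fun w => `|X i w| ^+ 3 * (1 + `|lin_sum (put i 0 (J w))|)) /\
  E (fun w => `|X i w| ^+ 3 * (1 + `|lin_sum (put i 0 (J w))|)) <=
  2 * E (fun w => `|X i w| ^+ 3).
Proof.
have [L e] := abs_lin_sum_put0 i.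
have LG : L1 (fun w => 1 + `|lin_sum (put i 0 (J w))|).
  by apply: L1D => //; exact: L1_cst.
have mpsi : measurable_fun setT (fun x : R => `|x| ^+ 3).
  by apply: measurable_funX; exact: normr_measurable.
have mG : measurable_fun setT (fun t : n.-tuple R => 1 + `|lin_sum t|).
  apply: measurable_funD => //; apply: measurableT_comp => //.
  exact: measurable_lin_sum.
have [L1p ->] := @Ex_independent _ _ _ _ _ _ mX indX i _ _ mpsi mG (X3 i) LG.
split=> //; rewrite mulrC ler_wpM2r//.
  by apply: Ex_ge0 => w; rewrite exprn_ge0.
rewrite ExD//; last exact: L1_cst.
by rewrite Ex_cst; lra.
Qed.

Variable gamma : R.
Hypothesis gamma_gt0 : 0 < gamma.
Hypothesis lyapunov : \sum_(i < n) E (fun w => `|X i w| ^+ 3) <= gamma.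

Definition trunc_sum w := \sum_(i < n) trunc_sqr gamma (X i w).

Lemma L1_trunc_sqr i : L1 (fun w => trunc_sqr gamma (X i w)).
Proof.
apply: (L1_le _ (L1Zl gamma (L1_absX mX X3 i))) => [|w].
  by apply: measurableT_comp => //; exact: measurable_trunc_sqr.
by rewrite ger0_norm ?trunc_sqr_le// trunc_sqr_ge0// ltW.
Qed.

(** Truncation at level [gamma] costs at most [gamma / (4 * gamma)] of the total
    variance. *)
Lemma Ex_trunc_sum : 2^-1 <= \sum_(i < n) E (fun w => X i w ^+ 2) ->
  4^-1 <= E trunc_sum.
Proof.
move=> var_ge; rewrite Ex_sum; last exact: L1_trunc_sqr.
rewrite -(ler_pM2l (_ : 0 < 4 * gamma)); last by rewrite mulr_gt0.
rewrite mulr_sumr.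
apply: (@le_trans _ _ (\sum_(i < n) (4 * gamma * E (fun w => X i w ^+ 2) -
    E (fun w => `|X i w| ^+ 3)))); last first.
  apply: ler_sum => i _.
  rewrite -!ExZl -?ExB; [|exact/L1Zl/L1_X2|exact: X3|exact: L1_trunc_sqr|exact: L1_X2].
  apply: Ex_le; [|exact/L1Zl/L1_trunc_sqr|].
    by apply: L1B; [exact/L1Zl/L1_X2|exact: X3].
  by move=> w; exact: trunc_sqr_ge.
rewrite sumrB -mulr_sumr.
have : 4 * gamma * 2^-1 <= 4 * gamma * \sum_(i < n) E (fun w => X i w ^+ 2).
  by rewrite ler_pM2l// mulr_gt0.
by move: lyapunov gamma_gt0; lra.
Qed.

(** A truncated square is at most [gamma * |x|], which gives the sum a variance of
    at most [gamma ^ 2]. *)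
Lemma trunc_sum_deviation :
  L1 (fun w => `|trunc_sum w - E trunc_sum|) /\
  E (fun w => `|trunc_sum w - E trunc_sum|) <= gamma.
Proof.
have g0 := ltW gamma_gt0.
pose q i x := trunc_sqr gamma x - E (fun w => trunc_sqr gamma (X i w)).
have Lt := L1_trunc_sqr.
have Lt2 i : L1 (fun w => trunc_sqr gamma (X i w) ^+ 2).
  apply: (L1_le _ (L1Zl (gamma ^+ 2) (L1_X2 mX X3 i))) => [|w].
    apply: measurable_funX; apply: measurableT_comp => //.
    exact: measurable_trunc_sqr.
  rewrite ger0_norm ?sqr_ge0// -[X i w ^+ 2]real_normK ?num_real// -exprMn.
  by rewrite ler_pXn2r ?nnegrE ?trunc_sqr_ge0 ?trunc_sqr_le ?mulr_ge0.
have qE i w : q i (X i w) ^+ 2 = trunc_sqr gamma (X i w) ^+ 2 -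
    (2 * E (fun w => trunc_sqr gamma (X i w))) * trunc_sqr gamma (X i w) +
    E (fun w => trunc_sqr gamma (X i w)) ^+ 2.
  by rewrite /q; ring.
have Lq2 i : L1 (fun w => q i (X i w) ^+ 2).
  apply: (L1_eq (fun w => esym (qE i w))).
  by apply: L1D; [apply: L1B => //; exact: L1Zl|exact: L1_cst].
have [|||L2 e2] := @Ex_sum_sqr _ _ _ _ _ _ mX indX q.
- move=> i; apply: measurable_funB => //; exact: measurable_trunc_sqr.
- exact: Lq2.
- move=> i; rewrite ExB//; last exact: L1_cst.
  by rewrite Ex_cst subrr.
have dE w : trunc_sum w - E trunc_sum = \sum_(i < n) q i (X i w).
  by rewrite /q sumrB Ex_sum.
(* only the first absolute moment is used, so Cauchy-Schwarz is replaced by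
   [2 * |s| <= gamma + s ^ 2 / gamma] *)
have L : L1 (fun w => `|trunc_sum w - E trunc_sum|).
  apply: L1_norm; apply: L1B; last exact: L1_cst.
  exact: L1_sum.
split=> //.
have V : E (fun w => (\sum_(i < n) q i (X i w)) ^+ 2) <= gamma ^+ 2.
  rewrite e2; apply: (@le_trans _ _ (gamma ^+ 2 * \sum_(i < n) E (fun w => X i w ^+ 2))).
    rewrite mulr_sumr; apply: ler_sum => i _.
    apply: (@le_trans _ _ (E (fun w => trunc_sqr gamma (X i w) ^+ 2))).
      rewrite (eq_Ex _ (qE i)) ExD; [|by apply: L1B => //; exact: L1Zl|exact: L1_cst].
      rewrite ExB//; last exact: L1Zl.
      rewrite ExZl// Ex_cst.
      by have := sqr_ge0 (E (fun w => trunc_sqr gamma (X i w))); lra.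
    rewrite -ExZl; last exact: L1_X2.
    apply: Ex_le => //; first exact/L1Zl/L1_X2.
    move=> w; rewrite -[X i w ^+ 2]real_normK ?num_real// -exprMn.
    by rewrite ler_pXn2r ?nnegrE ?trunc_sqr_ge0 ?trunc_sqr_le ?mulr_ge0.
  by rewrite ler_piMr// exprn_ge0.
have LB : L1 (fun w => 2^-1 * (gamma + gamma^-1 * (\sum_(i < n) q i (X i w)) ^+ 2)).
  by apply: L1Zl; apply: L1D; [exact: L1_cst|exact: L1Zl].
apply: (@le_trans _ _
    (E (fun w => 2^-1 * (gamma + gamma^-1 * (\sum_(i < n) q i (X i w)) ^+ 2)))).
  apply: Ex_le => // w; rewrite dE; set s := \sum_(i < n) _.
  rewrite -[s ^+ 2]real_normK ?num_real//.
  have h : 0 <= gamma^-1 * (`|s| - gamma) ^+ 2 by rewrite mulr_ge0 ?invr_ge0 ?sqr_ge0.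
  have -> : 2^-1 * (gamma + gamma^-1 * `|s| ^+ 2) =
      `|s| + 2^-1 * (gamma^-1 * (`|s| - gamma) ^+ 2).
    by field; rewrite gt_eqF.
  by rewrite lerDl mulr_ge0.
rewrite ExZl; last by apply: L1D; [exact: L1_cst|exact: L1Zl].
rewrite ExD; [|exact: L1_cst|exact: L1Zl].
rewrite Ex_cst ExZl//.
have : gamma^-1 * E (fun w => (\sum_(i < n) q i (X i w)) ^+ 2) <= gamma.
  by rewrite ler_pdivrMl// -expr2.
lra.
Qed.

(** Stein's argument with the test function [f w = clip (eta + gamma) (w - z)], where
    [W] is the weighted sum. On the one hand the expectation of [S * g U * f W] is
    at most twice [eta + gamma]. On the other hand, after leaving out each variable
    in turn, it is at least a multiple of the expectation of [trunc_sum] over the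
    event that [W] is in the window, up to third moments. As [trunc_sum] hardly
    deviates from its mean, which is at least [4^-1], this bounds the probability
    of the window. *)
Lemma concentration g z eta : weight g -> 0 <= eta ->
  2^-1 <= \sum_(i < n) E (fun w => X i w ^+ 2) ->
  E (fun w => (`|lin_sum (J w) * g (sqr_sum (J w)) - z| <= eta)%R%:R) <=
  200 * (eta + gamma).
Proof.
move=> wg eta0 var_ge.
have [mg gb gl] := wg.
have g0 := ltW gamma_gt0.
pose W (t : n.-tuple R) := lin_sum t * g (sqr_sum t).
have mgU : measurable_fun setT (fun t : n.-tuple R => g (sqr_sum t)).
  by apply: measurableT_comp => //; exact: measurable_sqr_sum.
have mW : measurable_fun setT W.
  by apply: measurable_funM => //; exact: measurable_lin_sum.
pose e w := `|W (J w) - z| <= eta.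
have me : measurable_fun setT e.
  have mWJ : measurable_fun setT (fun w => W (J w) - z).
    by apply: measurable_funB => //; exact: (measurableT_comp mW mJ).
  apply: measurable_fun_ler; last exact: measurable_cst.
  exact: (measurableT_comp (@normr_measurable R setT) mWJ).
have Le : L1 (fun w => (e w)%:R) by exact: L1_bool.
rewrite -[leLHS]/(E (fun w => (e w)%:R)).
set p := E _.
have p1 : p <= 1 by exact: Ex_bool_le1.
(* a clipping level at most [1] makes the cost of a change of the quadratic sum
   independent of [eta] *)
have [eps1|/ltW eps1] := leP 1 (eta + gamma); first by lra.
set eps := eta + gamma.
have eps0 : 0 <= eps by rewrite /eps; lra.
have eps_le1 : eps <= 1 by [].
pose f w := clip eps (w - z).
have fb w : `|f w| <= eps by exact: normr_clip.
have fl w w' : `|f w - f w'| <= 1 * `|w - w'|.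
  rewrite mul1r (le_trans (clip_lipschitz _ _ eps0))//.
  by rewrite opprB addrA subrK.
pose F s u := g u * f (s * g u).
pose G (t : n.-tuple R) := F (lin_sum t) (sqr_sum t).
have mG : measurable_fun setT G.
  apply: measurable_funM => //; apply: (measurableT_comp (@measurable_clip R eps)).
  exact: measurable_funB.
have Gb t : `|G t| <= 2 * eps.
  rewrite normrM ler_pM//.
  by have /andP[g1 g2] := gb (sqr_sum t); rewrite ger0_norm//; lra.
have LXi i : L1 (fun w => idfun (X i w)) by exact: L1_X.
have mid : measurable_fun setT (@idfun R) by exact: measurable_id.
(* the change of the linear sum gains a truncated square inside the window,
   the change of the quadratic sum costs a third moment *)
have step i w : 4^-1 * ((e w)%:R * trunc_sqr gamma (X i w)) -
    4 * (`|X i w| ^+ 3 * (1 + `|lin_sum (put i 0 (J w))|)) <=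
    X i w * (G (J w) - G (put i 0 (J w))).
  have Ssplit := lin_sum_split i (J w); rewrite tnth_joint in Ssplit.
  have Usplit := sqr_sum_split i (J w); rewrite tnth_joint in Usplit.
  set s' := lin_sum (put i 0 (J w)) in Ssplit *.
  set u' := sqr_sum (put i 0 (J w)) in Usplit *.
  set s := lin_sum (J w) in Ssplit *; set u := sqr_sum (J w) in Usplit *.
  have h2 : `|X i w * (F s' u - F s' u')| <=
      4 * (`|X i w| ^+ 3 * (1 + `|s'|)).
    rewrite normrM.
    have := weight_lipschitz_mul s' u u' wg fb fl.
    have -> : `|u - u'| = `|X i w| ^+ 2.
      by rewrite Usplit addrC addKr normrX.
    rewrite -/(F s' u) -/(F s' u').
    set D := `|F s' u - F s' u'| => hD.
    have hD4 : D <= `|X i w| ^+ 2 * (4 * (1 + `|s'|)).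
      apply: (le_trans hD); rewrite ler_wpM2l ?exprn_ge0//.
      have : 0 <= `|s'| by []. lra.
    apply: (le_trans (ler_wpM2l (normr_ge0 (X i w)) hD4)).
    by rewrite exprSr; lra.
  have /andP[gu1 _] := gb u.
  have h1 := @clip_weight_step R eta gamma z s (X i w) (g u) eta0 g0 gu1.
  have es : s - X i w = s' by rewrite Ssplit addrK.
  rewrite es -/eps in h1.
  rewrite -[G (J w)]/(F s u) -[G (put i 0 (J w))]/(F s' u').
  rewrite -(subrKA (F s' u)) mulrDr.
  have h1' : 4^-1 * ((e w)%:R * trunc_sqr gamma (X i w)) <= X i w * (F s u - F s' u).
    by rewrite mulrC; exact: h1.
  move: h2; rewrite ler_norml => /andP[h2 _]; lra.
have Lq := L1_trunc_sqr.
have Leq i : L1 (fun w => (e w)%:R * trunc_sqr gamma (X i w)).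
  apply: (L1_le _ (Lq i)) => [|w].
    apply: measurable_funM; first exact: measurable_natr_bool.
    exact: L1_measurable (Lq i).
  rewrite normrM (ger0_norm (trunc_sqr_ge0 _ g0)).
  by case: (e w); rewrite ?normr1 ?normr0 ?mul1r ?mul0r ?trunc_sqr_ge0.
have lower i : 4^-1 * E (fun w => (e w)%:R * trunc_sqr gamma (X i w)) -
    8 * E (fun w => `|X i w| ^+ 3) <= E (fun w => X i w * G (J w)).
  have [_ LD ->] := Ex_leave_one_out mX indX mid mG Gb (LXi i) (X0 i).
  have [Lc ec] := cube_mul_leave_one_out i.
  apply: (@le_trans _ _ (E (fun w => 4^-1 * ((e w)%:R * trunc_sqr gamma (X i w)) -
    4 * (`|X i w| ^+ 3 * (1 + `|lin_sum (put i 0 (J w))|))))); last first.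
    by apply: Ex_le => //; apply: L1B; exact: L1Zl.
  rewrite ExB; [|exact: L1Zl|exact: L1Zl].
  by rewrite !ExZl//; lra.
have LXG i : L1 (fun w => X i w * G (J w)).
  by have [] := Ex_leave_one_out mX indX mid mG Gb (LXi i) (X0 i).
have upper : \sum_(i < n) E (fun w => X i w * G (J w)) <= 2 * eps.
  rewrite -Ex_sum//.
  have [Ls es] := abs_lin_sum.
  apply: (@le_trans _ _ (E (fun w => 2 * eps * `|lin_sum (J w)|))).
    apply: Ex_le; [exact: L1_sum|exact: L1Zl|] => w.
    rewrite -mulr_suml.
    have -> : \sum_(i < n) X i w = lin_sum (J w).
      by apply: eq_bigr => i _; rewrite tnth_joint.
    apply: le_trans (ler_norm _) _; rewrite normrM mulrC.
    by rewrite ler_wpM2r.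
  by rewrite ExZl// ler_piMr// mulr_ge0.
have Q : p * 4^-1 - gamma <= \sum_(i < n) E (fun w => (e w)%:R * trunc_sqr gamma (X i w)).
  have [Ld ed] := trunc_sum_deviation.
  rewrite -Ex_sum//.
  have e1 : E (fun w => (e w)%:R * E trunc_sum - `|trunc_sum w - E trunc_sum|) <=
      E (fun w => \sum_(i < n) (e w)%:R * trunc_sqr gamma (X i w)).
    apply: Ex_le; [|exact: L1_sum|].
      by apply: L1B => //; exact: L1Zr.
    move=> w; rewrite -mulr_sumr -/(trunc_sum w).
    have : - (trunc_sum w - E trunc_sum) <= `|trunc_sum w - E trunc_sum|.
      by rewrite -normrN ler_norm.
    by case: (e w); rewrite ?mul1r ?mul0r; [lra|rewrite sub0r oppr_le0].
  apply: le_trans e1.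
  rewrite ExB//; last exact: L1Zr.
  rewrite ExZr// -/p.
  have : p * 4^-1 <= p * E trunc_sum.
    by rewrite ler_wpM2l ?Ex_trunc_sum//; exact: Ex_ge0.
  lra.
have low : \sum_(i < n) (4^-1 * E (fun w => (e w)%:R * trunc_sqr gamma (X i w)) -
    8 * E (fun w => `|X i w| ^+ 3)) <= \sum_(i < n) E (fun w => X i w * G (J w)).
  by apply: ler_sum => i _; exact: lower.
rewrite sumrB -!mulr_sumr in low.
move: lyapunov low upper Q eps0 g0; rewrite /eps.
set a := \sum_(i < n) _; set b := \sum_(i < n) _; set c := \sum_(i < n) _.
by move=> *; lra.
Qed.

End concentration.

(** * The inverse square root near one *)

Section inv_sqrt.
Context (R : realType).

Lemma lipschitz_measurable (f : R -> R) (K : R) :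
  (forall u v, `|f u - f v| <= K * `|u - v|) -> measurable_fun setT f.
Proof.
move=> fK; apply: continuous_measurable_fun => x.
have K1 : 0 < `|K| + 1 by rewrite ltr_wpDl.
apply/cvgrPdist_lt => e e0; near=> y.
apply: (le_lt_trans (fK _ _)).
apply: (@le_lt_trans _ _ ((`|K| + 1) * `|x - y|)).
  by rewrite ler_wpM2r// (le_trans (ler_norm _))// lerDl.
rewrite -ltr_pdivlMl//; near: y.
by apply: cvgr_dist_lt => //; rewrite mulr_gt0 ?invr_gt0.
Unshelve. all: by end_near. Qed.

(** The function [1 / sqrt u], frozen outside [[1/2, 3/2]]. *)
Definition inv_sqrt (u : R) : R := (Num.sqrt (1 + clip 2^-1 (u - 1)))^-1.

Lemma clip_half_bounds (u : R) : 2^-1 <= 1 + clip 2^-1 (u - 1) <= 3 / 2.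
Proof.
have : `|clip (2^-1 : R) (u - 1)| <= 2^-1 by apply: normr_clip.
by rewrite ler_norml => /andP[? ?]; apply/andP; split; lra.
Qed.

Lemma inv_sqrtV u : (inv_sqrt u) ^- 2 = 1 + clip 2^-1 (u - 1).
Proof.
have /andP[h _] := clip_half_bounds u.
by rewrite /inv_sqrt exprVn invrK sqr_sqrtr//; lra.
Qed.

Lemma inv_sqrt_gt0 u : 0 < inv_sqrt u.
Proof.
have /andP[h _] := clip_half_bounds u.
by rewrite invr_gt0 sqrtr_gt0; lra.
Qed.

Lemma sqr_inv_sqrt u : (inv_sqrt u) ^+ 2 * (1 + clip 2^-1 (u - 1)) = 1.
Proof. by rewrite -inv_sqrtV mulfV// expf_neq0// gt_eqF// inv_sqrt_gt0. Qed.

Lemma inv_sqrt_bounds u : 2^-1 <= inv_sqrt u <= 2.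
Proof.
have := inv_sqrt_gt0 u; have := sqr_inv_sqrt u; have /andP[h1 h2] := clip_half_bounds u.
by set g := inv_sqrt u; set c := 1 + _ in h1 h2 *; move=> e g0; apply/andP; split; nra.
Qed.

Lemma inv_sqrt_lipschitz u v : `|inv_sqrt u - inv_sqrt v| <= 2 * `|u - v|.
Proof.
have := inv_sqrt_gt0 u; have := inv_sqrt_gt0 v.
have := sqr_inv_sqrt u; have := sqr_inv_sqrt v.
have /andP[a1 a2] := clip_half_bounds u; have /andP[b1 b2] := clip_half_bounds v.
have cl : `|(1 + clip 2^-1 (v - 1)) - (1 + clip 2^-1 (u - 1))| <= `|u - v|.
  rewrite opprD addrACA subrr add0r (le_trans (clip_lipschitz _ _ _))//.
  by rewrite opprB addrA subrK distrC.
move: cl a1 a2 b1 b2; set a := 1 + clip _ (u - 1); set b := 1 + clip _ (v - 1).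
set g := inv_sqrt u; set h := inv_sqrt v => cl a1 a2 b1 b2 hb ga h0 g0.
have gh : (g - h) * (g + h) = (b - a) * (g ^+ 2 * h ^+ 2).
  have -> : (g - h) * (g + h) = g ^+ 2 * (h ^+ 2 * b) - h ^+ 2 * (g ^+ 2 * a).
    by rewrite ga hb; ring.
  ring.
have g2 : g ^+ 2 <= 2 by nra.
have h2 : h ^+ 2 <= 2 by nra.
have gh0 : 0 < g + h by lra.
have key : `|g - h| * (g + h) <= `|u - v| * (g ^+ 2 * h ^+ 2).
  rewrite -{1}(gtr0_norm gh0) -normrM gh normrM.
  have gh2 : 0 <= g ^+ 2 * h ^+ 2 by rewrite mulr_ge0 ?sqr_ge0.
  by rewrite (ger0_norm gh2); exact: ler_wpM2r.
have k2 : g ^+ 2 * h ^+ 2 <= 2 * (g + h).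
  have g_le2 : g <= 2 by nra.
  have h_le2 : h <= 2 by nra.
  have gh_le : g * h <= g + h.
    have : 0 <= g * (2 - h) + h * (2 - g) by rewrite addr_ge0// mulr_ge0//; lra.
    lra.
  have gh_le2 : g * h <= 2 by have := sqr_ge0 (g - h); lra.
  rewrite -exprMn expr2; apply: ler_pM => //; rewrite mulr_ge0//; lra.
rewrite -(ler_pM2r gh0) (le_trans key)//.
rewrite [leRHS](_ : _ = `|u - v| * (2 * (g + h))); last ring.
exact: ler_wpM2l.
Qed.

Lemma weight_inv_sqrt : weight inv_sqrt.
Proof.
split; [exact: lipschitz_measurable inv_sqrt_lipschitz|exact: inv_sqrt_bounds|].
exact: inv_sqrt_lipschitz.
Qed.

(** The left-hand side vanishes for [u] in [[1/2, 3/2]], where [inv_sqrt] is the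
    exact normalization; elsewhere the right-hand side is [2 * |u - 1|]. *)
Lemma normalization_defect u : 0 <= u ->
  `|1 - u * inv_sqrt u ^+ 2| <= 4 * ((u - 1) * clip 2^-1 (u - 1)).
Proof.
move=> u0; have := sqr_inv_sqrt u.
have /andP[a1 a2] := clip_half_bounds u.
have g0 := inv_sqrt_gt0 u.
have k : `|(u - 1) - clip 2^-1 (u - 1)| <= 2 * ((u - 1) * clip 2^-1 (u - 1)).
  move: (sqr_ge0 (u - 1)); rewrite ler_norml /clip.
  by case_min_max => ?; apply/andP; split; lra.
move: k a1 a2; set c := clip _ _ => k a1 a2 e.
have g2 : inv_sqrt u ^+ 2 <= 2 by move: (sqr_ge0 (inv_sqrt u)) => ?; nra.
have -> : 1 - u * inv_sqrt u ^+ 2 = - (inv_sqrt u ^+ 2 * (u - 1 - c)).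
  by rewrite -{1}e; ring.
rewrite normrN normrM (ger0_norm (sqr_ge0 _)).
apply: (@le_trans _ _ (2 * `|u - 1 - c|)); first by rewrite ler_wpM2r.
lra.
Qed.

End inv_sqrt.

Section zeroed_family.
Context (R : realType) dO (Omega : measurableType dO) (Pr : probability Omega R).
Context (n : nat) (X : 'I_n -> Omega -> R).

(** Replacing a variable by [0] rather than removing it keeps the index set. *)
Definition zeroed (i k : 'I_n) : Omega -> R := if k == i then fun=> 0 else X k.

Lemma joint_zeroed i w : joint (zeroed i) w = put i 0 (joint X w).
Proof.
apply: eq_from_tnth => k; rewrite tnth_joint tnth_put tnth_joint /zeroed.
by case: eqP.
Qed.

Lemma measurable_zeroed i : (forall k, measurable_fun setT (X k)) ->
  forall k, measurable_fun setT (zeroed i k).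
Proof. by move=> mX k; rewrite /zeroed; case: eqP. Qed.

(** A constant variable is independent of everything: the condition on it can be
    replaced by a full or an empty set. *)
Lemma independent_zeroed i : independent Pr X -> independent Pr (zeroed i).
Proof.
move=> indX A mA.
pose A' k := if k == i then (if `[< A i 0 >] then setT else set0) else A k.
have mA' k : measurable (A' k) by rewrite /A'; case: eqP => // _; case: ifP.
have preE k : zeroed i k @^-1` A k = X k @^-1` A' k.
  rewrite /zeroed /A'; have [->|//] := eqVneq k i.
  case: asboolP => h; apply/seteqP; split => w //=.
have -> : [set w | forall k, A k (zeroed i k w)] = [set w | forall k, A' k (X k w)].
  apply/seteqP; split => w /= h k; have := h k.
    by rewrite -[A k _]/((zeroed i k @^-1` A k) w) preE.
  by rewrite -[A' k _]/((X k @^-1` A' k) w) -preE.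
rewrite indX//; apply: eq_bigr => k _; by rewrite preE.
Qed.

End zeroed_family.

(** * Errors of the self-normalization *)

Section self_normalized.
Context (R : realType) dO (Omega : measurableType dO) (Pr : probability Omega R).
Context (n : nat) (X : 'I_n -> Omega -> R).
Hypothesis mX : forall i, measurable_fun setT (X i).
Hypothesis indX : independent Pr X.
Hypothesis X3 : forall i, L1 Pr (fun w => `|X i w| ^+ 3).

Local Notation L1 := (L1 Pr).
Local Notation E := (Ex Pr).
Local Notation J := (joint X).

Hypothesis X0 : forall i, E (X i) = 0.
Hypothesis var1 : \sum_(i < n) E (fun w => X i w ^+ 2) = 1.
Variable gamma : R.
Hypothesis gamma_gt0 : 0 < gamma.
Hypothesis lyapunov : \sum_(i < n) E (fun w => `|X i w| ^+ 3) <= gamma.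

Let mJ := measurable_joint mX.
Let var_le1 : \sum_(i < n) E (fun w => X i w ^+ 2) <= 1.
Proof. by rewrite var1. Qed.

Lemma measurable_sqr_sum_J : measurable_fun setT (fun w => sqr_sum (J w)).
Proof. by apply: measurableT_comp => //; exact: measurable_sqr_sum. Qed.

(** With third moments only, [|U - 1|] need not be of order [gamma] in mean. Its
    clipped square is: against the centered variables [X i ^+ 2 - E X i ^+ 2], the
    clipped deviation varies by at most [min 1 (X i ^+ 2) <= |X i|]. *)
Lemma sqr_sum_deviation :
  L1 (fun w => (sqr_sum (J w) - 1) * clip 2^-1 (sqr_sum (J w) - 1)) /\
  E (fun w => (sqr_sum (J w) - 1) * clip 2^-1 (sqr_sum (J w) - 1)) <= 2 * gamma.
Proof.
have h0 : (0 : R) <= 2^-1 by [].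
pose v i := E (fun w => X i w ^+ 2).
have v0 i : 0 <= v i by apply: Ex_ge0 => w; exact: sqr_ge0.
pose psi i x := x ^+ 2 - v i.
pose G (t : n.-tuple R) := clip 2^-1 (sqr_sum t - 1).
have mG : measurable_fun setT G.
  apply: (measurableT_comp (@measurable_clip R 2^-1)).
  by apply: measurable_funB => //; exact: measurable_sqr_sum.
have Gb t : `|G t| <= 2^-1 by exact: normr_clip.
have mpsi i : measurable_fun setT (psi i).
  by apply: measurable_funB => //; exact: measurable_funX.
have Lpsi i : L1 (fun w => psi i (X i w)).
  by apply: L1B; [exact: L1_X2|exact: L1_cst].
have psi0 i : E (fun w => psi i (X i w)) = 0.
  by rewrite ExB; [rewrite Ex_cst subrr|exact: L1_X2|exact: L1_cst].
have loo i := Ex_leave_one_out mX indX (mpsi i) mG Gb (Lpsi i) (psi0 i).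
have sumE w : (sqr_sum (J w) - 1) * clip 2^-1 (sqr_sum (J w) - 1) =
    \sum_(i < n) psi i (X i w) * G (J w).
  rewrite -mulr_suml sumrB var1; congr ((_ - _) * _).
  by apply: eq_bigr => i _; rewrite tnth_joint.
have LG i : L1 (fun w => psi i (X i w) * G (J w)) by have [] := loo i.
split; first exact: L1_eq (fun w => esym (sumE w)) (L1_sum _ LG).
rewrite (eq_Ex _ sumE) Ex_sum//.
apply: (@le_trans _ _ (\sum_(i < n) 2 * E (fun w => `|X i w| ^+ 3))); last first.
  by rewrite -mulr_sumr ler_pM2l.
apply: ler_sum => i _; have [_ LD ->] := loo i.
have Lb : L1 (fun w => `|X i w| ^+ 3 + v i * `|X i w|).
  by apply: L1D => //; exact/L1Zl/L1_absX.
apply: (@le_trans _ _ (E (fun w => `|X i w| ^+ 3 + v i * `|X i w|))).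
  apply: Ex_le => // w.
  have Usplit := sqr_sum_split i (J w); rewrite tnth_joint in Usplit.
  have d1 : `|G (J w) - G (put i 0 (J w))| <= `|X i w| ^+ 2.
    rewrite (le_trans (clip_lipschitz _ _ h0))// Usplit.
    by rewrite opprB addrA subrK addrC addKr normrX.
  have d2 : `|G (J w) - G (put i 0 (J w))| <= 1.
    rewrite (le_trans (ler_normB _ _))//.
    by have := Gb (J w); have := Gb (put i 0 (J w)); lra.
  have d3 : `|G (J w) - G (put i 0 (J w))| <= `|X i w|.
    have [x1|/ltW x1] := leP `|X i w| 1; last exact: le_trans x1.
    by rewrite (le_trans d1)// expr2 ler_piMl.
  apply: (le_trans (ler_norm _)); rewrite normrM.
  have p : `|psi i (X i w)| <= `|X i w| ^+ 2 + v i.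
    by rewrite (le_trans (ler_normB _ _))// normrX (ger0_norm (v0 i)).
  rewrite exprSr -mulrDl; exact: ler_pM.
rewrite ExD//; last exact/L1Zl/L1_absX.
rewrite ExZl; last exact: L1_absX.
by have := abs_mul_sqr_moment mX X3 i; rewrite -/(v i); lra.
Qed.

(** A single variance is small once the third moments are, since
    [y ^ 2 <= y ^ 3 + 4^-1] for [0 <= y]; hence the remaining variances keep at
    least half of the total. *)
Lemma var_le_half i : gamma <= 4^-1 -> E (fun w => X i w ^+ 2) <= 2^-1.
Proof.
move=> g4.
have tau : E (fun w => `|X i w| ^+ 3) <= gamma.
  apply: le_trans lyapunov; rewrite (bigD1 i)//= lerDl sumr_ge0// => k _.
  by apply: Ex_ge0 => w; rewrite exprn_ge0.
have : E (fun w => X i w ^+ 2) <= E (fun w => `|X i w| ^+ 3 + 4^-1).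
  apply: Ex_le; [exact: L1_X2|by apply: L1D => //; exact: L1_cst|] => w.
  rewrite -[X i w ^+ 2]real_normK ?num_real//.
  have := normr_ge0 (X i w); set y := `|X i w| => y0.
  have [y1|/ltW y1] := leP y 1.
    have : 0 <= y * (y - 2^-1) ^+ 2 by rewrite mulr_ge0 ?sqr_ge0.
    lra.
  have : y ^+ 2 <= y ^+ 3 by rewrite ler_weXn2l.
  lra.
rewrite ExD//; last exact: L1_cst.
by rewrite Ex_cst; lra.
Qed.

Lemma concentration_leave_one_out i g z eta : weight g -> 0 <= eta ->
  gamma <= 4^-1 ->
  E (fun w => (`|lin_sum (put i 0 (J w)) * g (sqr_sum (put i 0 (J w))) - z|
               <= eta)%R%:R) <= 200 * (eta + gamma).
Proof.
move=> wg eta0 g4.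
have mZ := measurable_zeroed i mX.
have ZE k w (f : R -> R) : f 0 = 0 ->
    f (zeroed X i k w) = (k != i)%:R * f (X k w).
  by rewrite /zeroed; case: eqP => _ f0; rewrite ?mul0r ?mul1r.
have Z3 k : L1 (fun w => `|zeroed X i k w| ^+ 3).
  apply: (L1_eq (f := fun w => (k != i)%:R * `|X k w| ^+ 3)); last exact: L1Zl.
  by move=> w; rewrite (ZE _ _ (fun x => `|x| ^+ 3))// normr0 expr0n.
have Z0 k : E (zeroed X i k) = 0.
  have -> : E (zeroed X i k) = E (fun w => (k != i)%:R * X k w).
    by apply: eq_Ex => w; rewrite -[LHS]/(idfun (zeroed X i k w)) ZE.
  by rewrite ExZl ?X0 ?mulr0//; exact: L1_X.
have Z2 : \sum_(k < n) E (fun w => zeroed X i k w ^+ 2) =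
    1 - E (fun w => X i w ^+ 2).
  rewrite -var1 [in RHS](bigD1 i)//= addrC addrK (bigD1 i)//=.
  have -> : E (fun w => zeroed X i i w ^+ 2) = 0.
    rewrite -[RHS](Ex_cst Pr 0); apply: eq_Ex => w.
    by rewrite /zeroed eqxx expr0n.
  rewrite add0r.
  by apply: eq_bigr => k ki; rewrite /zeroed (negbTE ki).
have Zl : \sum_(k < n) E (fun w => `|zeroed X i k w| ^+ 3) <= gamma.
  apply: le_trans lyapunov; apply: ler_sum => k _; apply: Ex_le => // w.
  rewrite (ZE _ _ (fun x => `|x| ^+ 3)) ?normr0 ?expr0n//.
  by case: (k != i); rewrite ?mul1r// mul0r exprn_ge0.
have v0 : 0 <= E (fun w => X i w ^+ 2) by apply: Ex_ge0 => w; exact: sqr_ge0.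
have vh := var_le_half i g4.
have := @concentration _ _ _ _ _ _ mZ (independent_zeroed i indX) Z3 Z0 _ gamma
  gamma_gt0 Zl g z eta wg eta0.
rewrite Z2 => h.
under eq_Ex do rewrite -joint_zeroed.
by apply: h; lra.
Qed.

(** Given [X i = x], the event concerns the sums without the [i]-th term, weighted by
    the shift [u |-> inv_sqrt (u + x ^+ 2)]. Keeping the shift inside the weight is
    essential: comparing [inv_sqrt (u + x ^+ 2)] with [inv_sqrt u] would widen the
    window by a multiple of the linear sum. *)
Lemma jump_term i z : gamma <= 4^-1 ->
  L1 (fun w => X i w ^+ 2 *
    (`|lin_sum (J w) * inv_sqrt (sqr_sum (J w)) - z| <=
     `|X i w| * inv_sqrt (sqr_sum (J w)))%R%:R) /\
  E (fun w => X i w ^+ 2 *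
    (`|lin_sum (J w) * inv_sqrt (sqr_sum (J w)) - z| <=
     `|X i w| * inv_sqrt (sqr_sum (J w)))%R%:R) <=
  200 * (4 * E (fun w => `|X i w| ^+ 3) + gamma * E (fun w => X i w ^+ 2)).
Proof.
move=> g4.
have [mg gb gl] := weight_inv_sqrt R.
pose e (t : n.-tuple R) := `|lin_sum t * inv_sqrt (sqr_sum t) - z| <=
     `|tnth t i| * inv_sqrt (sqr_sum t).
pose H (t : n.-tuple R) := tnth t i ^+ 2 * (e t)%:R.
have mgU : measurable_fun setT (fun t : n.-tuple R => inv_sqrt (sqr_sum t)).
  by apply: (measurableT_comp mg); exact: measurable_sqr_sum.
have mt : measurable_fun setT (fun t : n.-tuple R => tnth t i).
  exact: measurable_tnth.
have me : measurable_fun setT e.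
  apply: measurable_fun_ler.
    apply: (measurableT_comp (@normr_measurable R setT)).
    apply: measurable_funB => //; apply: measurable_funM => //.
    exact: measurable_lin_sum.
  apply: measurable_funM => //.
  exact: (measurableT_comp (@normr_measurable R setT) mt).
have mH : measurable_fun setT H.
  apply: measurable_funM; first exact: measurable_funX.
  by apply: (@measurableT_comp _ _ _ _ _ _ (fun b : bool => b%:R : R) _ e).
have H0 t : 0 <= H t by rewrite mulr_ge0 ?sqr_ge0.
pose b x := 200 * (4 * `|x| ^+ 3 + gamma * x ^+ 2).
have Lb : L1 (fun w => b (X i w)).
  by apply: L1Zl; apply: L1D; apply: L1Zl => //; exact: L1_X2.
have Hb x : L1 (fun w => H (put i x (J w))) /\ E (fun w => H (put i x (J w))) <= b x.
  have mHx := measurable_joint_put mX i x mH.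
  have LH : L1 (fun w => H (put i x (J w))).
    apply: (@L1_bounded _ _ _ _ (x ^+ 2)) => // w.
    rewrite ger0_norm// /H tnth_put eqxx.
    by case: (e _); rewrite ?mulr1// mulr0 sqr_ge0.
  split=> //.
  pose g u := inv_sqrt (u + x ^+ 2).
  have wg : weight g by exact/weight_shift/weight_inv_sqrt.
  pose e' w := `|lin_sum (put i 0 (J w)) * g (sqr_sum (put i 0 (J w))) - z|
               <= 4 * `|x|.
  have me' : measurable_fun setT e'.
    apply: measurable_fun_ler; last exact: measurable_cst.
    apply: (measurableT_comp (@normr_measurable R setT)).
    apply: measurable_funB => //.
    have [mg' _ _] := wg.
    apply: (measurable_joint_put mX i 0 (H := fun t => lin_sum t * g (sqr_sum t))).
    apply: measurable_funM; first exact: measurable_lin_sum.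
    by apply: (measurableT_comp mg'); exact: measurable_sqr_sum.
  have Le' : L1 (fun w => (e' w)%:R) by exact: L1_bool.
  apply: (@le_trans _ _ (E (fun w => x ^+ 2 * (e' w)%:R))).
    apply: Ex_le => //; first exact: L1Zl.
    move=> w; rewrite /H tnth_put eqxx ler_wpM2l ?sqr_ge0// ler_nat.
    rewrite /e lin_sum_put sqr_sum_put tnth_put eqxx -/(g _).
    set s := lin_sum _; set u := sqr_sum _.
    case: leP => //= h; suff -> : e' w by [].
    rewrite /e' -/s -/u.
    have /andP[g1 g2] := gb (u + x ^+ 2); rewrite -/(g u) in g1 g2.
    have -> : s * g u - z = (s + x) * g u - z - x * g u by ring.
    rewrite (le_trans (ler_normB _ _))// normrM (ger0_norm (_ : 0 <= g u)); last by lra.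
    have : `|x| * g u <= `|x| * 2 by rewrite ler_wpM2l.
    lra.
  rewrite ExZl// /b.
  have x40 : 0 <= 4 * `|x| by rewrite mulr_ge0.
  have c := concentration_leave_one_out i z wg x40 g4.
  apply: (le_trans (ler_wpM2l (sqr_ge0 x) c)).
  have -> : `|x| ^+ 3 = x ^+ 2 * `|x|.
    by rewrite exprSr real_normK ?num_real.
  lra.
have [LH EH] := Ex_le_conditional mX indX mH H0 Hb Lb.
have HE w : H (J w) = X i w ^+ 2 *
    (`|lin_sum (J w) * inv_sqrt (sqr_sum (J w)) - z| <=
     `|X i w| * inv_sqrt (sqr_sum (J w)))%R%:R.
  by rewrite /H /e tnth_joint.
split; first exact: L1_eq HE LH.
rewrite -(eq_Ex _ HE) (le_trans EH)//.
rewrite /b ExZl; last by apply: L1D; apply: L1Zl => //; exact: L1_X2.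
rewrite ExD; [|exact: L1Zl|exact/L1Zl/L1_X2].
rewrite !ExZl//; exact: L1_X2.
Qed.

End self_normalized.

(** * Berry-Esseen bound for self-normalized sums *)

Section stein_self_normalized.
Context (R : realType).

(** The function [F] for which [W * f W] is [S * F S U]. *)
Definition stein_test (z s u : R) : R := inv_sqrt u * stein_sol z (s * inv_sqrt u).

Lemma measurable_stein_sol (z : R) : measurable_fun setT (stein_sol z).
Proof. exact: lipschitz_measurable (@stein_sol_lipschitz R z). Qed.

Lemma normr_stein_test z s u : `|stein_test z s u| <= 2 * stein_bound R.
Proof.
have /andP[g1 g2] := inv_sqrt_bounds u.
rewrite normrM ler_pM//; last exact: normr_stein_sol.
by rewrite ger0_norm//; lra.
Qed.

(** The increment is split into the change of the linear sum, to which the expansion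
    of the Stein solution around its endpoint applies, and the change of the
    quadratic sum. Expanding at the endpoint, with the final value [u] of the
    quadratic sum, is what lets the main terms add up to
    [u * inv_sqrt u ^+ 2 * stein_deriv z w]. *)
Lemma stein_test_increment z x s s' u u' : s = s' + x -> u = u' + x ^+ 2 ->
  `|x * (stein_test z s u - stein_test z s' u') -
    x ^+ 2 * inv_sqrt u ^+ 2 * stein_deriv z (s * inv_sqrt u)| <=
  (stein_bound R + 4) * (18 * (`|x| ^+ 3 * (1 + `|s'|)) +
    4 * (x ^+ 2 * (`|s * inv_sqrt u - z| <= `|x| * inv_sqrt u)%R%:R)).
Proof.
move=> sE uE; have /andP[g1 g2] := inv_sqrt_bounds u.
have B2 := stein_bound_ge2 R; set B := stein_bound R in B2 *.
set g := inv_sqrt u in g1 g2 *; have g0 : 0 <= g by lra.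
set w := s * g; set D := stein_deriv z w.
have h2 : `|x * (stein_test z s' u - stein_test z s' u')| <=
    2 * (B + 4) * (`|x| ^+ 3 * (1 + `|s'|)).
  rewrite normrM.
  have := weight_lipschitz_mul s' u u' (weight_inv_sqrt R) (normr_stein_sol z)
    (stein_sol_lipschitz z).
  rewrite -/(stein_test z s' u) -/(stein_test z s' u') -/B.
  have -> : `|u - u'| = `|x| ^+ 2 by rewrite uE addrC addKr normrX.
  set d := `|_ - _| => hd.
  have s0 : 0 <= `|s'| by [].
  have hd2 : d <= `|x| ^+ 2 * (2 * (B + 4) * (1 + `|s'|)).
    apply: (le_trans hd); rewrite ler_wpM2l ?exprn_ge0//.
    have : 0 <= B * `|s'| by rewrite mulr_ge0//; lra.
    lra.
  apply: (le_trans (ler_wpM2l (normr_ge0 x) hd2)).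
  by rewrite [`|x| ^+ 3]exprSr; lra.
have e1 : x * (stein_test z s u - stein_test z s' u') - x ^+ 2 * g ^+ 2 * D =
    x * g * (stein_sol z w - stein_sol z (s' * g) - (w - s' * g) * D) +
    x * (stein_test z s' u - stein_test z s' u').
  rewrite /stein_test -/g -/w.
  have -> : w - s' * g = x * g by rewrite /w sE; ring.
  ring.
rewrite e1 (le_trans (ler_normD _ _))//.
have h1 : `|x * g * (stein_sol z w - stein_sol z (s' * g) - (w - s' * g) * D)| <=
    16 * ((B + 2) * (`|x| ^+ 3 * (1 + `|s'|))) +
    4 * ((B + 2) * (x ^+ 2 * (`|w - z| <= `|x| * g)%R%:R)).
  rewrite normrM; have := stein_sol_expansion z w (s' * g).
  rewrite -/B -/D.
  have -> : w - s' * g = x * g by rewrite /w sE; ring.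
  have nxg : `|x * g| = `|x| * g by rewrite normrM (ger0_norm g0).
  rewrite nxg; set j := (_ <= _)%R%:R; set d := `|_ - _| => hd.
  have j0 : 0 <= j by [].
  have s0 : 0 <= `|s'| by [].
  have xg2 : `|x| * g <= 2 * `|x| by rewrite mulrC ler_wpM2r.
  have x0 : 0 <= `|x| by [].
  have q1 : (x * g) ^+ 2 * (1 + `|s' * g|) <= 4 * `|x| ^+ 2 * (2 * (1 + `|s'|)).
    rewrite -[(x * g) ^+ 2]real_normK ?num_real// nxg; apply: ler_pM.
    - exact: sqr_ge0.
    - by rewrite addr_ge0.
    - rewrite [leRHS](_ : _ = (2 * `|x|) ^+ 2); last ring.
      by rewrite ler_pXn2r ?nnegrE ?mulr_ge0.
    - rewrite normrM (ger0_norm g0).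
      have : `|s'| * g <= `|s'| * 2 by rewrite ler_wpM2l.
      lra.
  have q2 : `|x| * g * j <= 2 * `|x| * j by rewrite ler_wpM2r.
  have hd2 : d <= (B + 2) * (4 * `|x| ^+ 2 * (2 * (1 + `|s'|)) + 2 * `|x| * j).
    apply: (le_trans hd); rewrite ler_wpM2l//; first by lra.
    exact: lerD.
  have xx : x ^+ 2 = `|x| * `|x| by rewrite -expr2 real_normK ?num_real.
  apply: (@le_trans _ _ (2 * `|x| *
      ((B + 2) * (4 * `|x| ^+ 2 * (2 * (1 + `|s'|)) + 2 * `|x| * j)))).
    apply: ler_pM => //; first by rewrite mulr_ge0.
    by rewrite /d.
  by rewrite xx [`|x| ^+ 3]exprSr; lra.
apply: (le_trans (lerD h1 h2)).
set c := `|x| ^+ 3 * _; set j := x ^+ 2 * _.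
have c0 : 0 <= c by rewrite mulr_ge0 ?exprn_ge0// addr_ge0.
have j0 : 0 <= j by rewrite mulr_ge0 ?sqr_ge0.
lra.
Qed.

End stein_self_normalized.

Section self_normalized_berry_esseen.
Context (R : realType) dO (Omega : measurableType dO) (Pr : probability Omega R).
Context (n : nat) (X : 'I_n -> Omega -> R).
Hypothesis mX : forall i, measurable_fun setT (X i).
Hypothesis indX : independent Pr X.
Hypothesis X3 : forall i, L1 Pr (fun w => `|X i w| ^+ 3).

Local Notation L1 := (L1 Pr).
Local Notation E := (Ex Pr).
Local Notation J := (joint X).

Hypothesis X0 : forall i, E (X i) = 0.
Hypothesis var1 : \sum_(i < n) E (fun w => X i w ^+ 2) = 1.
Variable gamma : R.
Hypothesis gamma_gt0 : 0 < gamma.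
Hypothesis lyapunov : \sum_(i < n) E (fun w => `|X i w| ^+ 3) <= gamma.

Let mJ := measurable_joint mX.
Let var_le1 : \sum_(i < n) E (fun w => X i w ^+ 2) <= 1.
Proof. by rewrite var1. Qed.

Local Notation W w := (lin_sum (J w) * inv_sqrt (sqr_sum (J w))).

Lemma measurable_W : measurable_fun setT (fun w => W w).
Proof.
have [mg _ _] := weight_inv_sqrt R.
apply: measurable_funM.
  by apply: measurableT_comp => //; exact: measurable_lin_sum.
by apply: (measurableT_comp mg); exact: measurable_sqr_sum_J.
Qed.

Lemma measurable_W_le z : measurable_fun setT (fun w => W w <= z).
Proof. by apply: measurable_fun_ler => //; exact: measurable_W. Qed.

Lemma berry_esseen_small z : gamma <= 4^-1 ->
  `|E (fun w => (W w <= z)%R%:R) - gauss_cdf z| <=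
  5000 * (stein_bound R + 4) * gamma.
Proof.
move=> g4; have B2 := stein_bound_ge2 R; set B := stein_bound R in B2 *.
have mW := measurable_W; have mWz := measurable_W_le z.
pose G (t : n.-tuple R) := stein_test z (lin_sum t) (sqr_sum t).
pose D w := stein_deriv z (W w).
have [mg gb _] := weight_inv_sqrt R.
have mf := @measurable_stein_sol R z.
have mG : measurable_fun setT G.
  have mgU : measurable_fun setT (fun t : n.-tuple R => inv_sqrt (sqr_sum t)).
    by apply: (measurableT_comp mg); exact: measurable_sqr_sum.
  apply: measurable_funM => //; apply: (measurableT_comp mf).
  by apply: measurable_funM => //; exact: measurable_lin_sum.
have Gb t : `|G t| <= 2 * B by exact: normr_stein_test.
have mD : measurable_fun setT D.
  apply: measurable_funD.
    by apply: measurable_funM => //; exact: (measurableT_comp mf mW).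
  by apply: measurable_funB => //; exact: measurable_natr_bool.
have LD : L1 D by apply: (L1_bounded Pr mD) => w; exact: normr_stein_deriv.
have LXi i : L1 (fun w => idfun (X i w)) by exact: L1_X.
have mid : measurable_fun setT (@idfun R) by exact: measurable_id.
have loo i := Ex_leave_one_out mX indX mid mG Gb (LXi i) (X0 i).
have LXG i : L1 (fun w => X i w * G (J w)) by have [] := loo i.
have LXD i : L1 (fun w => X i w * (G (J w) - G (put i 0 (J w)))) by have [] := loo i.
pose Z w := \sum_(i < n) X i w * (G (J w) - G (put i 0 (J w))).
have LZ : L1 Z by exact: L1_sum.
(* Stein's equation, with [X i * G J] replaced by its leave-one-out form *)
have stein : E (fun w => (W w <= z)%R%:R) - gauss_cdf z = E (fun w => D w - Z w).
  rewrite -[gauss_cdf z](Ex_cst Pr) -ExB; [|exact: L1_bool|exact: L1_cst].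
  have SE w : (W w <= z)%R%:R - gauss_cdf z = D w - \sum_(i < n) X i w * G (J w).
    rewrite -stein_solP; congr (_ - _); rewrite -mulr_suml.
    rewrite /G /stein_test mulrA; congr (_ * _ * _).
    by apply: eq_bigr => i _; rewrite tnth_joint.
  rewrite (eq_Ex _ SE) !ExB//; last exact: L1_sum.
  by rewrite !Ex_sum//; congr (_ - _); apply: eq_bigr => i _; have [] := loo i.
pose cube i w := `|X i w| ^+ 3 * (1 + `|lin_sum (put i 0 (J w))|).
pose jump i w := X i w ^+ 2 *
    (`|W w - z| <= `|X i w| * inv_sqrt (sqr_sum (J w)))%R%:R.
pose dev w := (sqr_sum (J w) - 1) * clip 2^-1 (sqr_sum (J w) - 1).
have cubeP i := cube_mul_leave_one_out mX indX X3 X0 var_le1 i.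
have jumpP i := jump_term mX indX X3 X0 var1 gamma_gt0 lyapunov i z g4.
have [Ldev Edev] := sqr_sum_deviation mX indX X3 var1 lyapunov.
have Lcube i : L1 (cube i) by have [] := cubeP i.
have Ljump i : L1 (jump i) by have [] := jumpP i.
pose err i w := (B + 4) * (18 * cube i w + 4 * jump i w).
have Lerr i : L1 (err i) by apply: L1Zl; apply: L1D; exact: L1Zl.
have pointwise w : `|D w - Z w| <= 8 * dev w + \sum_(i < n) err i w.
  (* the main terms cancel up to [1 - U * inv_sqrt U ^+ 2] *)
  have -> : D w - Z w =
      D w * (1 - sqr_sum (J w) * inv_sqrt (sqr_sum (J w)) ^+ 2) -
      \sum_(i < n) (X i w * (G (J w) - G (put i 0 (J w))) -
        X i w ^+ 2 * inv_sqrt (sqr_sum (J w)) ^+ 2 * D w).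
    rewrite sumrB -/(Z w) -!mulr_suml.
    have -> : \sum_(i < n) X i w ^+ 2 = sqr_sum (J w).
      by apply: eq_bigr => i _; rewrite tnth_joint.
    ring.
  rewrite (le_trans (ler_normB _ _))// lerD//.
    rewrite normrM; have := normalization_defect (sqr_sum_ge0 (J w)).
    rewrite -/(dev w) => h.
    apply: (le_trans (ler_pM _ _ (normr_stein_deriv z (W w)) h)) => //.
    by rewrite mulrA; lra.
  rewrite (le_trans (ler_norm_sum _ _ _))//; apply: ler_sum => i _.
  have Ssplit := lin_sum_split i (J w); rewrite tnth_joint in Ssplit.
  have Usplit := sqr_sum_split i (J w); rewrite tnth_joint in Usplit.
  exact: stein_test_increment Ssplit Usplit.
have Lb : L1 (fun w => 8 * dev w + \sum_(i < n) err i w).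
  by apply: L1D; [exact: L1Zl|exact: L1_sum].
rewrite stein (le_trans (Ex_norm_le _ Lb pointwise))//; first exact: L1B.
rewrite ExD; [|exact: L1Zl|exact: L1_sum].
rewrite ExZl// Ex_sum//.
have sum_err : \sum_(i < n) E (err i) <= (B + 4) * (4036 * gamma).
  apply: (@le_trans _ _ (\sum_(i < n) (B + 4) * (3236 * E (fun w => `|X i w| ^+ 3) +
      800 * gamma * E (fun w => X i w ^+ 2)))).
    apply: ler_sum => i _; rewrite ExZl; last by apply: L1D; exact: L1Zl.
    rewrite ler_wpM2l//; first by lra.
    rewrite ExD; [|exact: L1Zl|exact: L1Zl].
    rewrite !ExZl//.
    by have [_ ec] := cubeP i; have [_ ej] := jumpP i; rewrite /cube /jump; lra.
  rewrite -mulr_sumr ler_wpM2l//; first by lra.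
  by rewrite big_split/= -!mulr_sumr var1; move: lyapunov; lra.
have : 0 <= B * gamma by rewrite mulr_ge0 ?(ltW gamma_gt0)//; lra.
rewrite -/(dev _) in Edev *.
by move: gamma_gt0 Edev; rewrite -/dev; lra.
Qed.

(** For [gamma > 4^-1] the bound exceeds [1]. *)
Lemma self_normalized_berry_esseen z :
  `|E (fun w => (W w <= z)%R%:R) - gauss_cdf z| <=
  5000 * (stein_bound R + 4) * gamma.
Proof.
have [g4|/ltW g4] := leP gamma 4^-1; first exact: berry_esseen_small.
apply: (@le_trans _ _ 1).
  have p1 := Ex_bool_le1 Pr (measurable_W_le z).
  have p0 : 0 <= E (fun w => (W w <= z)%R%:R) by exact: Ex_ge0.
  have := gauss_cdf_ge0 z; have := gauss_cdf_le1 z.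
  by move=> *; rewrite ler_norml; apply/andP; split; lra.
have := stein_bound_ge2 R; set B := stein_bound R => B2.
have : 0 <= (B - 2) * (gamma - 4^-1) by rewrite mulr_ge0//; lra.
lra.
Qed.

End self_normalized_berry_esseen.

(** * Change of level between the two normalizations *)

Section gauss_shrink.
Context (R : realType).
Implicit Types z w a M : R.

Lemma gauss_density_le1 w : gauss_density w <= 1.
Proof.
apply: (le_trans (normal_pdf_ub 0 w (oner_neq0 R))).
rewrite /normal_peak expr1n mul1r.
have h : 1 <= Num.sqrt (pi *+ 2 : R).
  rewrite -[leLHS]sqrtr1 ler_wsqrtr//.
  by have := pi_ge2 R; rewrite mulr2n; lra.
by rewrite invf_le1// (lt_le_trans ltr01 h).
Qed.

Lemma gauss_cdf_lipschitz z w : `|gauss_cdf z - gauss_cdf w| <= `|z - w|.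
Proof.
have [c [_ _ ->]] := MVT_sym z w (@is_derive_gauss_cdf R).
rewrite normrM ler_piMl// ger0_norm ?gauss_density_le1//.
exact/ltW/gauss_density_gt0.
Qed.

(** From [1 + a ^ 2 / 2 <= expR (a ^ 2 / 2)]. *)
Lemma gauss_density_le_inv_sqr a : 0 < a -> gauss_density a <= 2 / a ^+ 2.
Proof.
move=> a0; have a2 : 0 < a ^+ 2 by rewrite exprn_gt0.
have e1 : 1 + a ^+ 2 / 2 <= expR (a ^+ 2 / 2) by exact: expR_ge1Dx.
have p1 : normal_peak (1 : R) <= 1.
  have := gauss_density_le1 0; rewrite gauss_densityE expr0n /= oppr0 mul0r expR0.
  by rewrite mulr1.
rewrite gauss_densityE mulNr expRN.
have E0 : 0 < expR (a ^+ 2 / 2) by exact: expR_gt0.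
rewrite ler_pdivrMr// mulrAC ler_pdivlMr//.
apply: (@le_trans _ _ (a ^+ 2)); first by rewrite ler_piMl// ltW.
lra.
Qed.

Lemma gauss_tail_cube_right a : 0 < a -> 1 - gauss_cdf a <= 2 / a ^+ 3.
Proof.
move=> a0; apply: (le_trans (gauss_tail_right a0)).
rewrite exprSr invfM mulrA ler_pM2r ?invr_gt0//.
exact: gauss_density_le_inv_sqr.
Qed.

Lemma gauss_tail_cube_left a : 0 < a -> gauss_cdf (- a) <= 2 / a ^+ 3.
Proof.
move=> a0; have na : - a < 0 by rewrite oppr_lt0.
apply: (le_trans (gauss_tail_left na)); rewrite opprK.
rewrite exprSr invfM mulrA ler_pM2r ?invr_gt0//.
have -> : gauss_density (- a) = gauss_density a by rewrite !gauss_densityE sqrrN.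
exact: gauss_density_le_inv_sqr.
Qed.

(** The level [z] for Student's statistic of [M] observations is the level
    [shrink M z] for the self-normalized sum. *)
Definition shrink M z : R := z / Num.sqrt (1 + z ^+ 2 / M).

Section shrink.
Variable M : R.
Hypothesis M_gt0 : 0 < M.

Let den z := Num.sqrt (1 + z ^+ 2 / M).

Let den2 z : den z ^+ 2 = 1 + z ^+ 2 / M.
Proof. by rewrite sqr_sqrtr// addr_ge0// divr_ge0 ?sqr_ge0// ltW. Qed.

Let den_ge1 z : 1 <= den z.
Proof.
rewrite -(@ler_pXn2r _ 2)// ?nnegrE ?sqrtr_ge0// den2 expr1n lerDl.
by rewrite divr_ge0 ?sqr_ge0// ltW.
Qed.

Let den_gt0 z : 0 < den z.
Proof. exact: lt_le_trans (den_ge1 z). Qed.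

Let inv_den_le1 z : (den z)^-1 <= 1.
Proof. by rewrite invf_le1 ?den_gt0. Qed.

Lemma shrink_gt0 z : 0 < z -> 0 < shrink M z.
Proof. by move=> z0; rewrite divr_gt0// den_gt0. Qed.

Lemma shrinkN z : shrink M (- z) = - shrink M z.
Proof. by rewrite /shrink sqrrN mulNr. Qed.

Lemma shrink_ge0 z : 0 <= z -> 0 <= shrink M z.
Proof. by move=> z0; rewrite divr_ge0// ltW. Qed.

Lemma sqr_shrink z : shrink M z ^+ 2 * (1 + z ^+ 2 / M) = z ^+ 2.
Proof. by rewrite -den2 -exprMn /shrink -/(den z) divfK// gt_eqF. Qed.

(** Monotonicity is read off the squares, where [shrink] is the homographic function
    [t |-> t / (1 + t / M)]. *)
Lemma shrink_lt_pos z w : 0 <= z -> z < w -> shrink M z < shrink M w.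
Proof.
move=> z0 zw; have w0 : 0 <= w by lra.
rewrite -(@ltr_pXn2r _ 2)// ?nnegrE ?shrink_ge0//.
have M0 : 0 < M^-1 by rewrite invr_gt0.
have := sqr_shrink z; have := sqr_shrink w.
have dz : 1 <= 1 + z ^+ 2 / M by rewrite -den2 exprn_ege1.
have dw : 1 <= 1 + w ^+ 2 / M by rewrite -den2 exprn_ege1.
have zw2 : z ^+ 2 < w ^+ 2 by rewrite ltr_pXn2r ?nnegrE.
rewrite ltNge; set p := shrink M z ^+ 2; set q := shrink M w ^+ 2 => eq ep.
apply/negP => qp.
have e : (p - q) * (1 + z ^+ 2 / M + w ^+ 2 / M + z ^+ 2 / M * (w ^+ 2 / M)) =
    (z ^+ 2 - w ^+ 2).
  transitivity (p * (1 + z ^+ 2 / M) * (1 + w ^+ 2 / M) -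
      q * (1 + w ^+ 2 / M) * (1 + z ^+ 2 / M)); first ring.
  by rewrite ep eq; ring.
have : 0 <= z ^+ 2 - w ^+ 2.
  rewrite -e mulr_ge0 ?subr_ge0//.
  have : 0 <= z ^+ 2 / M * (w ^+ 2 / M) by rewrite mulr_ge0//; lra.
  lra.
lra.
Qed.

Lemma shrink_lt z w : z < w -> shrink M z < shrink M w.
Proof.
move=> zw; have [z0|z0] := leP 0 z; first exact: shrink_lt_pos.
have [w0|w0] := leP 0 w.
  apply: lt_le_trans (shrink_ge0 w0).
  by rewrite /shrink pmulr_llt0// invr_gt0; exact: den_gt0.
rewrite -ltrN2 -!shrinkN; apply: shrink_lt_pos; lra.
Qed.

Lemma shrink_le z w : (shrink M z <= shrink M w) = (z <= w).
Proof.
have [|wz] := leP z w.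
  by rewrite le_eqVlt => /predU1P[->|/shrink_lt/ltW //]; rewrite lexx.
by apply/negbTE; rewrite -ltNge shrink_lt.
Qed.

Lemma shrink_diff z : `|z - shrink M z| <= `|z| ^+ 3 / (2 * M).
Proof.
have -> : z - shrink M z = shrink M z * (den z - 1).
  by rewrite mulrBr mulr1 /shrink -/(den z) divfK// gt_eqF.
have d1 := den_ge1 z; have d2 := den2 z.
have dle : den z - 1 <= z ^+ 2 / M / 2 by have := sqr_ge0 (den z - 1); lra.
rewrite normrM [X in _ * X]ger0_norm ?subr_ge0//.
rewrite -[leRHS](_ : `|z| * (z ^+ 2 / M / 2) = _); last first.
  rewrite -[z ^+ 2]real_normK ?num_real// [`|z| ^+ 3]exprS.
  by field; rewrite gt_eqF.
apply: ler_pM => //; rewrite ?subr_ge0//.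
rewrite /shrink -/(den z) normrM ler_piMr// ger0_norm ?invr_ge0 ?(ltW (den_gt0 _))//.
Qed.

Lemma inv_cube_shrink z : 0 < z -> 1 <= M -> Num.sqrt M <= z ^+ 3 ->
  (shrink M z ^+ 3)^-1 <= 3 / Num.sqrt M.
Proof.
move=> z0 M1 zM.
have s0 : 0 < Num.sqrt M by rewrite sqrtr_gt0.
have y0 := shrink_gt0 z0.
rewrite -[leLHS]div1r ler_pdivrMr ?exprn_gt0// mulrAC ler_pdivlMr// mul1r.
set y := shrink M z in y0 *.
have y3 : 0 < y ^+ 3 by rewrite exprn_gt0.
have y33 : 0 <= 3 * y ^+ 3 by move: y3; lra.
rewrite -(@ler_pXn2r _ 2)// ?nnegrE ?sqrtr_ge0//.
rewrite sqr_sqrtr ?(ltW M_gt0)//.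
have zM2 : M <= z ^+ 6.
  have -> : z ^+ 6 = (z ^+ 3) ^+ 2 by rewrite -exprM.
  rewrite -[leLHS]sqr_sqrtr ?(ltW M_gt0)// ler_pXn2r ?nnegrE ?sqrtr_ge0//.
  by rewrite exprn_ge0// ltW.
(* [1 / y ^ 2 = 1 / z ^ 2 + 1 / M], and cubes of sums are controlled by sums of cubes *)
have yE : z ^+ 2 * M = y ^+ 2 * (M + z ^+ 2).
  by rewrite -{1}(sqr_shrink z) -/y; field; rewrite gt_eqF.
have z2 : 0 < z ^+ 2 by rewrite exprn_gt0.
have y2 : 0 < y ^+ 2 by rewrite exprn_gt0.
have c : (z ^+ 2 + M) ^+ 3 <= 8 * (z ^+ 6 * M ^+ 2).
  have M3 : M ^+ 3 <= z ^+ 6 * M ^+ 2 by rewrite exprS ler_wpM2r ?sqr_ge0.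
  have z6 : z ^+ 6 <= z ^+ 6 * M ^+ 2.
    by rewrite ler_peMr ?exprn_ege1// exprn_ge0// ltW.
  have cv : (z ^+ 2 + M) ^+ 3 <= 4 * (z ^+ 6 + M ^+ 3).
    have : 0 <= (z ^+ 2 + M) * (z ^+ 2 - M) ^+ 2.
      by rewrite mulr_ge0 ?sqr_ge0//; lra.
    have -> : z ^+ 6 = (z ^+ 2) ^+ 3 by rewrite -exprM.
    by set t := z ^+ 2; lra.
  lra.
have yz : y ^+ 6 * (z ^+ 2 + M) ^+ 3 = z ^+ 6 * M ^+ 3.
  have -> : y ^+ 6 * (z ^+ 2 + M) ^+ 3 = (y ^+ 2 * (M + z ^+ 2)) ^+ 3 by ring.
  by rewrite -yE; ring.
have y6 : 0 <= y ^+ 6 by rewrite exprn_ge0// ltW.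
have zM0 : 0 < z ^+ 6 * M ^+ 2 by rewrite mulr_gt0// exprn_gt0.
rewrite -(ler_pM2l zM0).
have -> : z ^+ 6 * M ^+ 2 * M = y ^+ 6 * (z ^+ 2 + M) ^+ 3 by rewrite yz; ring.
apply: (le_trans (ler_wpM2l y6 c)).
have := mulr_ge0 y6 (ltW zM0); lra.
Qed.

(** For [|z| ^ 3 <= sqrt M] the two levels are within [|z| ^ 3 / (2 * M)] of each other;
    otherwise both are in a tail of mass at most a multiple of [1 / sqrt M]. *)
Lemma gauss_cdf_shrink z : 1 <= M ->
  `|gauss_cdf z - gauss_cdf (shrink M z)| <= 6 / Num.sqrt M.
Proof.
move=> M1.
have s0 : 0 < Num.sqrt M by rewrite sqrtr_gt0.
have M2 : M = Num.sqrt M ^+ 2 by rewrite sqr_sqrtr// ltW.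
have [zs|/ltW sz] := leP (`|z| ^+ 3) (Num.sqrt M).
  apply: (le_trans (gauss_cdf_lipschitz _ _)); apply: (le_trans (shrink_diff z)).
  rewrite ler_pdivrMr ?mulr_gt0//.
  apply: (le_trans zs); rewrite {3}M2.
  rewrite [leRHS](_ : _ = 12 * Num.sqrt M); first by lra.
  by field; rewrite gt_eqF.
have z0 : z != 0.
  by apply/eqP => z0; move: sz; rewrite z0 normr0 expr0n /=; lra.
have [zp|zn] := leP 0 z.
  rewrite (ger0_norm zp) in sz; have z1 : 0 < z by rewrite lt_def z0.
  have y0 := shrink_gt0 z1.
  have yz : shrink M z <= z.
    by rewrite /shrink ler_piMr//; exact: inv_den_le1.
  rewrite ger0_norm ?subr_ge0 ?gauss_cdf_le//.
  have := gauss_tail_cube_right y0; have := inv_cube_shrink z1 M1 sz.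
  have := gauss_cdf_le1 z; lra.
rewrite (ltr0_norm zn) in sz.
have z1 : 0 < - z by rewrite oppr_gt0.
have y0 := shrink_gt0 z1.
have yz : z <= shrink M z.
  by rewrite -lerN2 -shrinkN /shrink ler_piMr// ?(ltW z1)//; exact: inv_den_le1.
rewrite distrC ger0_norm ?subr_ge0 ?gauss_cdf_le//.
have := gauss_tail_cube_left y0; rewrite -shrinkN opprK.
have := inv_cube_shrink z1 M1 sz.
have := gauss_cdf_ge0 z; lra.
Qed.

End shrink.
End gauss_shrink.

(** * Berry-Esseen bound for Student's statistic *)

Section student.
Context (R : realType) (m : nat).
Implicit Types (y : 'I_m -> R) (z c : R).

Definition mean y : R := m%:R^-1 * \sum_(i < m) y i.

Definition student y : R :=
  Num.sqrt m%:R * mean y / Num.sqrt (m%:R^-1 * \sum_(i < m) (y i - mean y) ^+ 2).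

Lemma studentZ c y : 0 < c -> student (fun i => c * y i) = student y.
Proof.
move=> c0; rewrite /student.
have -> : mean (fun i => c * y i) = c * mean y by rewrite /mean -mulr_sumr mulrCA.
have -> : \sum_(i < m) (c * y i - c * mean y) ^+ 2 =
    c ^+ 2 * \sum_(i < m) (y i - mean y) ^+ 2.
  by rewrite mulr_sumr; apply: eq_bigr => i _; rewrite -mulrBr exprMn.
rewrite (mulrCA _ (c ^+ 2)) sqrtrM ?sqr_ge0// sqrtr_sqr gtr0_norm//.
by rewrite mulrCA invfM mulrACA divff ?mul1r// gt_eqF.
Qed.

Hypothesis m_gt0 : (0 < m)%N.

Lemma sum_sqr_dev y : \sum_(i < m) (y i - mean y) ^+ 2 =
  \sum_(i < m) y i ^+ 2 - (\sum_(i < m) y i) ^+ 2 / m%:R.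
Proof.
have m0 : (m%:R : R) != 0 by rewrite pnatr_eq0 -lt0n.
under eq_bigr do rewrite sqrrB.
rewrite big_split/= sumrB sumr_const card_ord sumrMnl -mulr_suml.
by rewrite /mean -mulr_natr; field.
Qed.

(** With [V = U - S ^ 2 / m], Student's statistic is [T = S / sqrt V], so that
    [U = V * (1 + T ^ 2 / m)] and [S / sqrt U] is [shrink m T]. *)
Lemma student_le y z : let S := \sum_(i < m) y i in
  let U := \sum_(i < m) y i ^+ 2 in
  `|U - 1| <= 2^-1 -> S ^+ 2 < m%:R / 2 ->
  (student y <= z) = (S * inv_sqrt U <= shrink m%:R z).
Proof.
move=> S U U1 Sm.
have m0 : 0 < (m%:R : R) by rewrite ltr0n.
pose V := U - S ^+ 2 / m%:R.
have U2 : 2^-1 <= U by move: U1; rewrite ler_norml => /andP[]; lra.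
have U0 : 0 < U by lra.
have V0 : 0 < V by rewrite subr_gt0 ltr_pdivrMr//; nra.
have sU : inv_sqrt U = (Num.sqrt U)^-1.
  by rewrite /inv_sqrt clip_id// addrC subrK.
have sm0 : 0 < Num.sqrt (m%:R : R) by rewrite sqrtr_gt0.
have sV0 : 0 < Num.sqrt V by rewrite sqrtr_gt0.
have sU0 : 0 < Num.sqrt U by rewrite sqrtr_gt0.
have smE : (Num.sqrt (m%:R : R)) ^+ 2 = m%:R by rewrite sqr_sqrtr// ltW.
have sT : student y = S / Num.sqrt V.
  rewrite /student sum_sqr_dev -/S -/U -/V /mean -/S sqrtrM ?invr_ge0 ?(ltW m0)//.
  rewrite sqrtrV ?(ltW m0)// -{2}smE.
  by field; rewrite !gt_eqF.
have shT : shrink m%:R (S / Num.sqrt V) = S / Num.sqrt U.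
  rewrite /shrink.
  have -> : 1 + (S / Num.sqrt V) ^+ 2 / m%:R = U / V.
    have UV : U = V + S ^+ 2 / m%:R by rewrite subrK.
    rewrite expr_div_n sqr_sqrtr ?(ltW V0)// {1}UV mulrDl divff ?gt_eqF//.
    by rewrite mulrAC.
  rewrite sqrtrM ?(ltW U0)// sqrtrV ?(ltW V0)//.
  by field; rewrite !gt_eqF.
by rewrite sU -shT -sT shrink_le.
Qed.

End student.

Section measurable_student.
Context (R : realType) d (T : measurableType d) (m : nat).

(** A form in which the division by a possibly vanishing root is visibly measurable. *)
Lemma ratio_le (a v z : R) :
  (a / Num.sqrt v <= z) = if 0 < v then a <= z * Num.sqrt v else 0 <= z.
Proof.
case: ifPn => [v0|]; first by rewrite ler_pdivrMr// sqrtr_gt0.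
by rewrite -leNgt => v0; rewrite ler0_sqrtr// invr0 mulr0.
Qed.

Lemma measurable_student_le (Y : 'I_m -> T -> R) (z : R) :
  (forall i, measurable_fun setT (Y i)) ->
  measurable_fun setT (fun w => student (fun i => Y i w) <= z).
Proof.
move=> mY; have mmean : measurable_fun setT (fun w => mean (fun i => Y i w)).
  by apply: measurable_funM => //; apply: measurable_sum.
pose v w := m%:R^-1 * \sum_(i < m) (Y i w - mean (fun i => Y i w)) ^+ 2.
have mv : measurable_fun setT v.
  apply: measurable_funM => //; apply: measurable_sum => i.
  by apply: measurable_funX; exact: measurable_funB.
have ma : measurable_fun setT (fun w => Num.sqrt m%:R * mean (fun i => Y i w)).
  exact: measurable_funM.
rewrite (_ : (fun w => _) = fun w => if 0 < v w then
    Num.sqrt m%:R * mean (fun i => Y i w) <= z * Num.sqrt (v w) else 0 <= z); last first.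
  by apply/funext => w; rewrite /student ratio_le.
apply: measurable_fun_ifT => //; first exact: measurable_fun_ltr.
apply: measurable_fun_ler => //; apply: measurable_funM => //.
by apply: measurableT_comp => //; apply: continuous_measurable_fun; exact: sqrt_continuous.
Qed.

End measurable_student.

Definition student_const (R : realType) : R := 5000 * (stein_bound R + 4) + 16.

Section student_berry_esseen.
Context (R : realType) dO (Omega : measurableType dO) (Pr : probability Omega R).
Context (m : nat).
Hypothesis m_gt0 : (0 < m)%N.

Local Notation L1 := (L1 Pr).
Local Notation E := (Ex Pr).

Section normalized.
Variable X : 'I_m -> Omega -> R.
Hypothesis mX : forall i, measurable_fun setT (X i).
Hypothesis indX : independent Pr X.
Hypothesis X3 : forall i, L1 (fun w => `|X i w| ^+ 3).
Hypothesis X0 : forall i, E (X i) = 0.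
Hypothesis var1 : \sum_(i < m) E (fun w => X i w ^+ 2) = 1.
Variable gamma : R.
Hypothesis lyapunov : \sum_(i < m) E (fun w => `|X i w| ^+ 3) <= gamma.
Hypothesis gamma_ge : (Num.sqrt m%:R)^-1 <= gamma.

(** Outside the event that [U] is far from [1] or [S ^ 2] is at least [m / 2], both of
    probability [O(gamma)], Student's statistic and the self-normalized sum have the
    same position with respect to their levels. *)
Lemma student_berry_esseen_normalized z :
  `|E (fun w => (student (fun i => X i w) <= z)%R%:R) - gauss_cdf z| <=
  student_const R * gamma.
Proof.
have m1 : 1 <= (m%:R : R) by rewrite ler1n.
have m0 : 0 < (m%:R : R) by rewrite ltr0n.
have sm1 : 1 <= Num.sqrt (m%:R : R) by rewrite -[leLHS]sqrtr1 ler_wsqrtr.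
have sm0 : 0 < Num.sqrt (m%:R : R) by lra.
have g0 : 0 < gamma by apply: lt_le_trans gamma_ge; rewrite invr_gt0.
have im : (m%:R : R)^-1 <= gamma.
  apply: le_trans gamma_ge; rewrite lef_pV2 ?posrE//.
  by rewrite -[leRHS]sqr_sqrtr ?(ltW m0)// expr2 ler_peMl// ltW.
pose S w := \sum_(i < m) X i w.
pose U w := \sum_(i < m) X i w ^+ 2.
have SE w : lin_sum (joint X w) = S w by apply: eq_bigr => i _; rewrite tnth_joint.
have UE w : sqr_sum (joint X w) = U w by apply: eq_bigr => i _; rewrite tnth_joint.
have [LS2 ES2] := @Ex_sum_sqr _ _ _ _ _ _ mX indX (fun _ => idfun)
  (fun _ => @measurable_id _ _ _) (L1_X2 mX X3) X0.
have {ES2} ES2 : E (fun w => S w ^+ 2) = 1 by rewrite ES2.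
have [Ldev Edev] := sqr_sum_deviation mX indX X3 var1 lyapunov.
set z' := shrink m%:R z.
pose T w := student (fun i => X i w) <= z.
pose W w := lin_sum (joint X w) * inv_sqrt (sqr_sum (joint X w)) <= z'.
have mT : measurable_fun setT T by exact: measurable_student_le.
have mW : measurable_fun setT W by exact: measurable_W_le.
pose dev w := (sqr_sum (joint X w) - 1) * clip 2^-1 (sqr_sum (joint X w) - 1).
have dev_ge w : 0 <= dev w /\ (2^-1 < `|sqr_sum (joint X w) - 1| -> 4^-1 <= dev w).
  rewrite /dev; set x := sqr_sum _ - 1.
  have x2 : 0 <= x * x by rewrite -expr2 sqr_ge0.
  clearbody x; split=> [|xh]; first by rewrite /clip; case_min_max; lra.
  have h2 : 4^-1 <= x * x.
    rewrite -[x * x]expr2 -real_normK ?num_real//.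
    by have := sqr_ge0 (`|x| - 2^-1); lra.
  rewrite /clip; move: xh; have [x0|x0] := leP 0 x.
    by rewrite ger0_norm// => xh; case_min_max; lra.
  by rewrite ltr0_norm// => xh; case_min_max; lra.
have pw w : `|(T w)%:R - (W w)%:R : R| <= 4 * dev w + 2 * m%:R^-1 * S w ^+ 2.
  have [d0 d1] := dev_ge w.
  have im0 : 0 <= 2 * (m%:R^-1 : R) by rewrite mulr_ge0// invr_ge0 ler0n.
  have S0 : 0 <= 2 * m%:R^-1 * S w ^+ 2 by rewrite mulr_ge0// sqr_ge0.
  have le1 : `|(T w)%:R - (W w)%:R : R| <= 1.
    by case: (T w); case: (W w); rewrite /= ?subrr ?subr0 ?sub0r ?normrN ?normr1 ?normr0.
  have [U1|U1] := leP `|sqr_sum (joint X w) - 1| 2^-1; last first.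
    by rewrite (le_trans le1)//; have := d1 U1; lra.
  have [Sm|Sm] := ltP (S w ^+ 2) (m%:R / 2).
    rewrite /T /W; rewrite UE in U1.
    by rewrite (student_le m_gt0 z U1 Sm) -/(S w) SE UE subrr normr0 addr_ge0// mulr_ge0.
  have : 1 <= 2 * m%:R^-1 * S w ^+ 2.
    apply: le_trans (ler_wpM2l im0 Sm).
    by rewrite [leRHS](_ : _ = 1)//; field; rewrite gt_eqF.
  move=> h; lra.
have LT : L1 (fun w => (T w)%:R) by exact: L1_bool.
have LW : L1 (fun w => (W w)%:R) by exact: L1_bool.
have Lb : L1 (fun w => 4 * dev w + 2 * m%:R^-1 * S w ^+ 2).
  by apply: L1D; exact: L1Zl.
have step1 : `|E (fun w => (T w)%:R) - E (fun w => (W w)%:R)| <= 10 * gamma.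
  rewrite -ExB// (le_trans (Ex_norm_le _ Lb pw))//; first exact: L1B.
  rewrite ExD; [|exact: L1Zl|exact: L1Zl].
  by rewrite !ExZl// ES2; move: Edev; rewrite -/dev; lra.
have step2 := self_normalized_berry_esseen mX indX X3 X0 var1 g0 lyapunov z'.
rewrite -[E _]/(E (fun w => (W w)%:R)) in step2.
have step3 : `|gauss_cdf z - gauss_cdf z'| <= 6 * gamma.
  by apply: (le_trans (gauss_cdf_shrink m0 z m1)); rewrite ler_pM2l.
rewrite -[E _]/(E (fun w => (T w)%:R)) /student_const.
have -> : E (fun w => (T w)%:R) - gauss_cdf z =
  (E (fun w => (T w)%:R) - E (fun w => (W w)%:R)) +
  (E (fun w => (W w)%:R) - gauss_cdf z') - (gauss_cdf z - gauss_cdf z') by ring.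
rewrite (le_trans (ler_normB _ _))//.
rewrite (le_trans (lerD (ler_normD _ _) step3))//.
lra.
Qed.

End normalized.

Lemma independent_comp d (T : measurableType d) d' (T' : measurableType d') n
    (X : 'I_n -> Omega -> T) (f : 'I_n -> T -> T') :
  (forall i, measurable_fun setT (f i)) -> independent Pr X ->
  independent Pr (fun i => f i \o X i).
Proof.
move=> mf indX A mA; apply: (indX (fun i => f i @^-1` A i)) => i.
by rewrite -[X in measurable X]setTI; exact: mf.
Qed.

(** Rescaling the variables by [1 / (sigma * sqrt m)] leaves Student's statistic
    unchanged and reduces to the normalized case with [gamma = L / sqrt m]. *)
Lemma student_berry_esseen (Y : 'I_m -> Omega -> R) (sigma L : R) z :
  (forall i, measurable_fun setT (Y i)) -> independent Pr Y ->
  (forall i, L1 (fun w => `|Y i w| ^+ 3)) -> (forall i, E (Y i) = 0) ->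
  0 < sigma -> (forall i, E (fun w => Y i w ^+ 2) = sigma ^+ 2) ->
  1 <= L -> (forall i, E (fun w => `|Y i w| ^+ 3) <= L * sigma ^+ 3) ->
  `|E (fun w => (student (fun i => Y i w) <= z)%R%:R) - gauss_cdf z| <=
  student_const R * (L / Num.sqrt m%:R).
Proof.
move=> mY indY Y3 Y0 s0 Y2 L1' YL.
have m0 : 0 < (m%:R : R) by rewrite ltr0n.
pose r := Num.sqrt (m%:R : R).
have sm0 : 0 < r by rewrite sqrtr_gt0.
have smE : r ^+ 2 = m%:R by rewrite sqr_sqrtr// ltW.
pose c := (sigma * r)^-1.
have c0 : 0 < c by rewrite invr_gt0 mulr_gt0.
pose X i w := c * Y i w.
have LY2 i : L1 (fun w => Y i w ^+ 2) by exact: L1_X2.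
have LY i : L1 (Y i) by exact: L1_X.
have mX i : measurable_fun setT (X i) by exact: measurable_funM.
have indX : independent Pr X.
  apply: (independent_comp (f := fun _ x => c * x)) indY => i.
  exact: measurable_funM.
have cubeE i w : `|X i w| ^+ 3 = c ^+ 3 * `|Y i w| ^+ 3.
  by rewrite normrM (gtr0_norm c0) exprMn.
have sqrE i w : X i w ^+ 2 = c ^+ 2 * Y i w ^+ 2 by rewrite exprMn.
have X3 i : L1 (fun w => `|X i w| ^+ 3).
  by apply: (L1_eq (fun w => esym (cubeE i w))); exact: L1Zl.
have X0 i : E (X i) = 0 by rewrite ExZl// Y0 mulr0.
have var1 : \sum_(i < m) E (fun w => X i w ^+ 2) = 1.
  rewrite (eq_bigr (fun=> m%:R^-1)) => [|i _].
    by rewrite sumr_const card_ord -[LHS]mulr_natl divff// gt_eqF.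
  rewrite (eq_Ex _ (sqrE i)) ExZl// Y2 /c -smE.
  by field; rewrite !gt_eqF.
have ly : \sum_(i < m) E (fun w => `|X i w| ^+ 3) <= L / r.
  apply: (@le_trans _ _ (\sum_(i < m) c ^+ 3 * (L * sigma ^+ 3))).
    apply: ler_sum => i _; rewrite (eq_Ex _ (cubeE i)) ExZl//.
    by rewrite ler_wpM2l ?YL// exprn_ge0// ltW.
  rewrite sumr_const card_ord -mulr_natl -smE /c.
  rewrite [leLHS](_ : _ = L / r)//.
  by field; rewrite !gt_eqF.
have ge : r^-1 <= L / r.
  by rewrite ler_peMl// invr_ge0 ltW.
have := student_berry_esseen_normalized mX indX X3 X0 var1 ly ge z.
by under eq_Ex do rewrite studentZ//.
Qed.

End student_berry_esseen.

(** * Moments of the projected observations *)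

Section dot_products.
Context (R : realType) (d : nat).
Implicit Types u v x : d.-tuple R.

Lemma dot_origin u x : dot u (vsub x (origin R d)) = dot u x.
Proof.
by apply: eq_bigr => k _; rewrite !tnth_mktuple subr0.
Qed.

Lemma dot_ge0 v : 0 <= dot v v.
Proof. by apply: sumr_ge0 => k _; rewrite -expr2 sqr_ge0. Qed.

Lemma dot_eq0 v : (dot v v == 0) = (v == origin R d).
Proof.
apply/idP/eqP => [|->]; last first.
  by apply/eqP; rewrite /dot big1// => k _; rewrite tnth_mktuple mul0r.
rewrite /dot psumr_eq0 => [/allP v0|k _]; last by rewrite -expr2 sqr_ge0.
apply: eq_from_tnth => k; rewrite tnth_mktuple.
by have := v0 k (mem_index_enum _); rewrite -expr2 sqrf_eq0 => /eqP.
Qed.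

Lemma measurable_dot dA (A : measurableType dA) (f g : A -> d.-tuple R) :
  measurable_fun setT f -> measurable_fun setT g ->
  measurable_fun setT (fun w => dot (f w) (g w)).
Proof.
move=> mf mg; apply: measurable_sum => k.
have mt : measurable_fun setT (fun x : d.-tuple R => tnth x k).
  exact: measurable_tnth.
apply: measurable_funM; first exact: (measurableT_comp mt mf).
exact: (measurableT_comp mt mg).
Qed.

Definition unit_of v : d.-tuple R := [tuple (Num.sqrt (dot v v))^-1 * tnth v k | k < d].

Lemma dot_unit_of v x : 0 < dot v v ->
  dot v x = Num.sqrt (dot v v) * dot (unit_of v) x.
Proof.
move=> v0; rewrite [RHS]mulr_sumr; apply: eq_bigr => k _.
by rewrite tnth_mktuple !mulrA divff ?mul1r// gt_eqF// sqrtr_gt0.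
Qed.

Lemma unit_sphere_unit_of v : 0 < dot v v -> unit_sphere (unit_of v).
Proof.
move=> v0; rewrite /unit_sphere /=.
suff -> : dot (unit_of v) (unit_of v) = 1 by rewrite sqrtr1.
have -> : dot (unit_of v) (unit_of v) = (Num.sqrt (dot v v)) ^- 2 * dot v v.
  rewrite mulr_sumr; apply: eq_bigr => k _; rewrite !tnth_mktuple.
  by rewrite mulrACA -expr2 exprVn.
by rewrite sqr_sqrtr ?dot_ge0// mulVf// gt_eqF.
Qed.

End dot_products.

Section moments_of_P.
Context (R : realType) (d : nat) (P : probability (d.-tuple R) R) (L : R).
Hypothesis L_gt1 : 1 < L.
Hypothesis PL : lyapunov_assumption L P (origin R d).

Let mdot u : measurable_fun setT (fun x : d.-tuple R => dot u x).
Proof. exact: measurable_dot. Qed.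

(** The quotient in the Lyapunov assumption being finite excludes an infinite third
    moment; it then only remains to cube the inequality. *)
Lemma unit_direction u : unit_sphere u ->
  [/\ L1 P (fun x => `|dot u x| ^+ 3), 0 < Ex P (fun x => dot u x ^+ 2) &
  Ex P (fun x => `|dot u x| ^+ 3) <=
    L * Num.sqrt (Ex P (fun x => dot u x ^+ 2)) ^+ 3].
Proof.
move=> su; have [_ _ [M2 M3]] := PL.
have mE p : abs_moment P (origin R d) u p = (\int[P]_x (`|dot u x| ^+ p)%:E)%E.
  rewrite /abs_moment unlock; apply: eq_integral => x _.
  by rewrite dot_origin.
have mp p : measurable_fun setT (fun x : d.-tuple R => `|dot u x| ^+ p).
  by apply: measurable_funX; exact: (measurableT_comp (@normr_measurable R setT)).
have /andP[] := M2 u su; rewrite mE => m2pos m2fin.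
have L2 : L1 P (fun x => `|dot u x| ^+ 2).
  by apply: L1_ge0_lty => // x; rewrite exprn_ge0.
have m2E : Ex P (fun x => `|dot u x| ^+ 2) = Ex P (fun x => dot u x ^+ 2).
  by apply: eq_Ex => x; rewrite real_normK ?num_real.
set a := Ex P (fun x => dot u x ^+ 2).
have a0 : 0 < a by rewrite -lte_fin /a -m2E -Ex_EFin.
have sa0 : 0 < Num.sqrt a by rewrite sqrtr_gt0.
have : (abs_moment P (origin R d) u 3 `^ (3^-1)%R /
    abs_moment P (origin R d) u 2 `^ (2^-1)%R <= (L `^ 3^-1)%:E)%E.
  by apply: le_trans M3; apply: ereal_sup_ubound; exists u.
rewrite [in X in (_ / X)%E]mE Ex_EFin// m2E -/a.
rewrite poweR_EFin powR12_sqrt ?(ltW a0)// inver gt_eqF//.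
have m3ge0 : (0 <= abs_moment P (origin R d) u 3)%E.
  by rewrite mE integral_ge0// => x _; rewrite lee_fin exprn_ge0.
have L0 : 0 <= L by exact: ltW (lt_trans ltr01 L_gt1).
move: (mE 3%N) m3ge0; case: (abs_moment P (origin R d) u 3) => [b|_ _|//]; last first.
  by rewrite poweRyr// gt0_mulye ?leye_eq// lte_fin invr_gt0.
move=> bE b0; rewrite lee_fin in b0; rewrite poweR_EFin -EFinM lee_fin => hb.
have L3 : L1 P (fun x => `|dot u x| ^+ 3).
  by apply: L1_ge0_lty => [//|x|]; [rewrite exprn_ge0|rewrite -bE ltry].
have Eb : Ex P (fun x => `|dot u x| ^+ 3) = b.
  by apply: EFin_inj; rewrite -Ex_EFin// -bE.
split=> //; rewrite Eb.
have cube (x : R) : 0 <= x -> (x `^ 3^-1) ^+ 3 = x.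
  by move=> x0; rewrite -powR_mulrn ?powR_ge0// -powRrM mulVf ?powRr1// pnatr_eq0.
move: hb; rewrite ler_pdivrMr// => hb.
rewrite -(cube b b0) -(cube L L0) -exprMn.
by rewrite ler_pXn2r ?nnegrE ?mulr_ge0 ?powR_ge0// ltW.
Qed.

Lemma direction_moments v : v != origin R d -> exists sigma : R,
  [/\ 0 < sigma, L1 P (fun x => `|dot v x| ^+ 3),
      Ex P (fun x => dot v x) = 0,
      Ex P (fun x => dot v x ^+ 2) = sigma ^+ 2 &
      Ex P (fun x => `|dot v x| ^+ 3) <= L * sigma ^+ 3].
Proof.
move=> v0; have dv : 0 < dot v v by rewrite lt_def dot_eq0 v0 dot_ge0.
set s := Num.sqrt (dot v v); have s0 : 0 < s by rewrite sqrtr_gt0.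
have [L3 a0 bL] := unit_direction (unit_sphere_unit_of dv).
set u := unit_of v in L3 a0 bL; set a := Ex P _ in a0 bL.
have L2 : L1 P (fun x => dot u x ^+ 2).
  apply: (L1_le _ (L1D (L1_cst _ 1) L3)) => [|x]; first exact: measurable_funX.
  by rewrite ger0_norm ?sqr_ge0//; exact: sqr_le_1cube.
have sq : Num.sqrt a ^+ 2 = a by rewrite sqr_sqrtr// ltW.
have cubeE x : `|dot v x| ^+ 3 = s ^+ 3 * `|dot u x| ^+ 3.
  by rewrite dot_unit_of// normrM gtr0_norm// exprMn.
have sqrE x : dot v x ^+ 2 = s ^+ 2 * dot u x ^+ 2 by rewrite dot_unit_of// exprMn.
exists (s * Num.sqrt a); split.
- by rewrite mulr_gt0// sqrtr_gt0.
- by apply: (L1_eq (fun x => esym (cubeE x))); exact: L1Zl.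
- have [_ mean0 _] := PL.
  have Lk k : L1 P (fun x => tnth x k) by have [] := mean0 k.
  rewrite Ex_sum => [|k]; last exact: L1Zl.
  rewrite big1// => k _; rewrite ExZl//.
  have [_] := mean0 k; rewrite unlock tnth_mktuple => e.
  suff -> : Ex P (fun x => tnth x k) = 0 by rewrite mulr0.
  by apply: EFin_inj; rewrite -Ex_EFin.
- by rewrite (eq_Ex _ sqrE) ExZl// exprMn sq.
- rewrite (eq_Ex _ cubeE) ExZl// exprMn mulrCA ler_wpM2l//.
  by rewrite exprn_ge0// ltW.
Qed.

End moments_of_P.

Section law.
Context (R : realType) dO dT (Omega : measurableType dO) (T : measurableType dT).
Context (Pr : probability Omega R) (P : probability T R) (X : {RV Pr >-> T}).
Hypothesis XP : forall A, measurable A -> distribution Pr X A = P A.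

Lemma law_L1 (f : T -> R) : measurable_fun setT f -> L1 P f -> L1 Pr (f \o X).
Proof.
move=> mf /integrableP[_ foo]; apply/integrableP; split.
  by apply/measurable_EFinP; exact: measurableT_comp.
rewrite (_ : (\int[Pr]_x _)%E = (\int[P]_x `|(f x)%:E|)%E)//.
transitivity (\int[distribution Pr X]_x `|(f x)%:E|)%E.
  rewrite ge0_integral_pushforward//; apply: measurableT_comp => //.
  exact/measurable_EFinP.
by apply: eq_measure_integral => A mA _; exact: XP.
Qed.

Lemma law_Ex (f : T -> R) : measurable_fun setT f -> L1 P f ->
  Ex Pr (f \o X) = Ex P f.
Proof.
move=> mf Lf; have Lf' := law_L1 mf Lf.
apply: EFin_inj; rewrite -!Ex_EFin//.
transitivity (\int[distribution Pr X]_x (f x)%:E)%E.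
  have mEf : measurable_fun setT (EFin \o f) by exact/measurable_EFinP.
  have mX : measurable_fun setT X by [].
  exact: (esym (integral_pushforward mX mEf Lf' measurableT)).
by apply: eq_measure_integral => A mA _; exact: XP.
Qed.

End law.

Lemma prode_split_ord (R : realType) m n (a : 'I_(m + n) -> \bar R) :
  (\prod_(i < m + n) a i =
   \prod_(i < m) a (lshift n i) * \prod_(j < n) a (rshift m j))%E.
Proof. by rewrite big_split_ord. Qed.

(** * The statistic built from a split sample *)

Section sample.
Context (R : realType) dO (Omega : measurableType dO) (Pr : probability Omega R).
Context d (T : measurableType d).

Lemma mutually_independent_independent n (X : 'I_n -> {RV Pr >-> T}) :
  mutually_independent X -> independent Pr (fun i => X i : Omega -> T).
Proof.
move=> indX A mA; have := indX [set: 'I_n]%SET A mA.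
rewrite (_ : \bigcap_(i in _) _ = [set w | forall i, A i (X i w)]).
  by move=> ->; apply: eq_bigl => i; rewrite inE.
apply/seteqP; split => w /= h i; first by apply: h; rewrite /= inE.
by move=> _; exact: h.
Qed.

(** The sets that correspond to the other indices are taken full. *)
Lemma independent_lshift m1 m2 (X : 'I_(m1 + m2) -> Omega -> T) :
  (forall i, measurable_fun setT (X i)) ->
  independent Pr X -> independent Pr (fun i => X (lshift m2 i)).
Proof.
move=> mX indX A mA.
pose A' (k : 'I_(m1 + m2)) := match fintype.split k with inl i => A i | inr _ => setT end.
have mA' k : measurable (A' k) by rewrite /A'; case: fintype.split.
have A'l i : A' (lshift m2 i) = A i by rewrite /A' (unsplitK (inl i)).
have A'r j : A' (rshift m1 j) = setT by rewrite /A' (unsplitK (inr j)).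
have -> : [set w | forall i, A i (X (lshift m2 i) w)] =
    [set w | forall k, A' k (X k w)].
  apply/seteqP; split => w /= h i; last by have := h (lshift m2 i); rewrite A'l.
  by rewrite /A'; case: fintype.splitP => j ij //; rewrite (_ : i = lshift m2 j)//; exact: val_inj.
have PT : forall k, A' k = setT -> Pr (X k @^-1` A' k) = 1%E.
  by move=> k ->; rewrite preimage_setT probability_setT.
rewrite (indX A' mA').
transitivity ((\prod_(i < m1) Pr (X (lshift m2 i) @^-1` A' (lshift m2 i))) *
   \prod_(j < m2) Pr (X (rshift m1 j) @^-1` A' (rshift m1 j)))%E.
  exact: prode_split_ord.
rewrite [X in (_ * X)%E]big1 ?mule1; last by move=> j _; exact/PT/A'r.
by apply: eq_bigr => i _; rewrite A'l.
Qed.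

Context n (X : 'I_n -> Omega -> T).
Hypothesis mX : forall i, measurable_fun setT (X i).
Hypothesis indX : independent Pr X.

(** The conditional probability given the entries in [J], integrated. *)
Lemma Ex_resampling (J : {pred 'I_n}) (e : n.-tuple T -> bool) :
  measurable_fun setT e ->
  L1 Pr (fun w => Ex Pr (fun v => (e (mix J (joint X w) (joint X v)))%:R)) /\
  Ex Pr (fun w => (e (joint X w))%:R) =
  Ex Pr (fun w => Ex Pr (fun v => (e (mix J (joint X w) (joint X v)))%:R)).
Proof.
move=> me; have mJ := measurable_joint mX.
pose H (t : n.-tuple T) : R := (e t)%:R.
have mH : measurable_fun setT H by exact: measurable_natr_bool.
have mEH : measurable_fun setT (EFin \o H) by exact/measurable_EFinP.
have H0 t : (0 <= (EFin \o H) t)%E by rewrite lee_fin.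
have m2 : measurable_fun setT (fun p : Omega * Omega => mix J (joint X p.1) (joint X p.2)).
  exact: (measurable_resample mX).
have mev w : measurable_fun setT (fun v => e (mix J (joint X w) (joint X v))).
  by apply: (measurableT_comp me); apply: measurable_mix.
have Lv w : L1 Pr (fun v => (e (mix J (joint X w) (joint X v)))%:R) by exact: L1_bool.
pose h w := Ex Pr (fun v => (e (mix J (joint X w) (joint X v)))%:R : R).
have hE w : (\int[Pr]_v (EFin \o H) (mix J (joint X w) (joint X v)))%E = (h w)%:E.
  by rewrite -Ex_EFin.
have mF : measurable_fun setT
    (fun p : Omega * Omega => (EFin \o H) (mix J (joint X p.1) (joint X p.2))).
  exact: (measurableT_comp mEH m2).
have mh : measurable_fun setT h.
  apply/measurable_EFinP.
  rewrite (_ : EFin \o h = fun w =>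
    (\int[Pr]_v (EFin \o H) (mix J (joint X w) (joint X v)))%E); last first.
    by apply/funext => w; rewrite hE.
  exact: (@measurable_fun_fubini_tonelli_F _ _ _ _ _ Pr _ mF (fun p => H0 _)).
have Lh : L1 Pr h.
  apply: (L1_bounded Pr (c := 1) mh) => w; rewrite ger0_norm; last exact: Ex_ge0.
  exact: Ex_bool_le1.
split=> //; apply: EFin_inj; rewrite -!Ex_EFin//; last first.
  by apply: L1_bool; exact: measurableT_comp.
have := ge0_integral_resampling mX indX J mEH H0.
by move=> ->; apply: eq_integral => w _; rewrite hE.
Qed.

End sample.

Section main.
Context (R : realType) (d m1 m2 : nat).
Context (P : probability (d.-tuple R) R) (L : R).
Hypothesis m1_gt0 : (0 < m1)%N.
Hypothesis m2_gt0 : (0 < m2)%N.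
Hypothesis L_gt1 : 1 < L.
Hypothesis PL : lyapunov_assumption L P (origin R d).

Context dO (Omega : measurableType dO) (Pr : probability Omega R).
Variable X : 'I_(m1 + m2) -> {RV Pr >-> d.-tuple R}.
Hypothesis iidX : iid X P.

Let Xf i : Omega -> d.-tuple R := X i.
Let mX i : measurable_fun setT (Xf i). Proof. by []. Qed.
Let indX : independent Pr Xf.
Proof. by have [h _] := iidX; exact: mutually_independent_independent. Qed.
Let lawX i A : measurable A -> distribution Pr (X i) A = P A.
Proof. by have [_ h] := iidX; exact: h. Qed.

Local Notation sample := ((m1 + m2).-tuple (d.-tuple R)).
Implicit Types (t s : sample).

Definition direction t : d.-tuple R :=
  [tuple m2%:R^-1 * \sum_(j < m2) tnth (tnth t (rshift m1 j)) k | k < d].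

Lemma f_mean_direction t v : f_mean (tnth t) v = dot (direction t) v.
Proof.
rewrite /f_mean /dot exchange_big/= mulr_sumr; apply: eq_bigr => k _.
by rewrite tnth_mktuple -mulr_suml mulrA.
Qed.

Lemma T_mean_student t : T_mean (tnth t) =
  student (fun i => dot (direction t) (tnth t (lshift m2 i))).
Proof.
have fE : f_mean (tnth t) = dot (direction t) by apply/funext => v; exact: f_mean_direction.
by rewrite /T_mean /f_mean_bar fE.
Qed.

Let measurable_entry i : measurable_fun setT (fun t : sample => tnth t i).
Proof. exact: measurable_tnth. Qed.

Lemma measurable_direction : measurable_fun setT direction.
Proof.
apply/measurable_fun_tnthP => k.
rewrite (_ : _ \o _ = fun t =>
    m2%:R^-1 * \sum_(j < m2) tnth (tnth t (rshift m1 j)) k); last first.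
  by apply/funext => t /=; rewrite tnth_mktuple.
apply: measurable_funM => //; apply: measurable_sum => j.
have mk : measurable_fun setT (fun x : d.-tuple R => tnth x k).
  exact: measurable_tnth.
exact: (measurableT_comp mk (measurable_entry _)).
Qed.

Lemma measurable_T_mean_le z : measurable_fun setT (fun t : sample => T_mean (tnth t) <= z).
Proof.
rewrite (_ : (fun t => _) = fun t =>
    student (fun i => dot (direction t) (tnth t (lshift m2 i))) <= z); last first.
  by apply/funext => t; rewrite T_mean_student.
apply: measurable_student_le => i; apply: measurable_dot; last exact: measurable_entry.
exact: measurable_direction.
Qed.

(** The event that the direction is the origin, in a form that is visibly
    measurable. *)
Definition degenerate t := dot (direction t) (direction t) == 0.

Lemma measurable_degenerate : measurable_fun setT degenerate.
Proof.
apply: measurable_fun_eqr => //.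
by apply: measurable_dot; exact: measurable_direction.
Qed.

Lemma measurable_point (c : d.-tuple R) : measurable [set c].
Proof.
rewrite (_ : [set c] = box (fun k => [set tnth c k])).
  by apply: measurable_box => k.
apply/seteqP; split => [x /= -> //|x /= h].
by apply: eq_from_tnth => k; exact: h.
Qed.

(** Given all the observations but one, a single value of the remaining one makes
    the direction vanish, and [P] has no atoms. *)
Lemma degenerate_null : Ex Pr (fun w => (degenerate (joint Xf w))%:R) = 0.
Proof.
pose j0 := Ordinal m2_gt0; pose i0 := rshift m1 j0.
have [_ ->] := Ex_resampling mX indX (predC1 i0) measurable_degenerate.
rewrite -[RHS](Ex_cst Pr 0); apply: eq_Ex => w.
have m2E : (m2%:R : R) != 0 by rewrite pnatr_eq0 -lt0n.
pose c : d.-tuple R :=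
  [tuple - \sum_(j < m2 | j != j0) tnth (Xf (rshift m1 j) w) k | k < d].
have sub v : degenerate (mix (predC1 i0) (joint Xf w) (joint Xf v)) -> Xf i0 v = c.
  rewrite /degenerate dot_eq0 => /eqP e0; apply: eq_from_tnth => k.
  have := congr1 (fun x => tnth x k) e0; rewrite !tnth_mktuple => /eqP.
  rewrite mulf_eq0 invr_eq0 (negbTE m2E)/= (bigD1 j0)//= !tnth_mktuple.
  rewrite inE/= eqxx/= addr_eq0 => /eqP ->; congr (- _).
  apply: eq_bigr => j jj0; rewrite !tnth_mktuple inE/=.
  by rewrite (inj_eq (@rshift_inj _ _)) jj0.
have mev : measurable_fun setT
    (fun v => degenerate (mix (predC1 i0) (joint Xf w) (joint Xf v))).
  apply: (measurableT_comp measurable_degenerate); apply: measurable_mix => //.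
  exact: measurable_joint.
apply: EFin_inj; rewrite -prob_Ex//; apply/eqP; rewrite eq_le measure_ge0 andbT.
have [noatom _ _] := PL.
have c0 : Pr (Xf i0 @^-1` [set c]) = 0%E.
  exact: etrans (lawX i0 (measurable_point c)) (noatom c).
apply: (@le_trans _ _ (Pr (Xf i0 @^-1` [set c]))); last by rewrite c0.
apply: le_measure; rewrite ?inE.
- by have := mev measurableT [set true] I; rewrite setTI.
- exact: (measurable_preimage_X mX i0 (measurable_point c)).
- by move=> v /sub.
Qed.

(** Conditionally on the last [m2] observations, unless the direction vanishes,
    this is the bound for Student's statistic of the projected observations. *)
Lemma T_mean_berry_esseen z :
  (`|Pr [set w | (T_mean (fun i => X i w) <= z)%R] - Phi z| <=
   (student_const R * (L / Num.sqrt m1%:R))%:E)%E.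
Proof.
set b := student_const R * _.
have b0 : 0 <= b.
  have := stein_bound_ge2 R => B2.
  rewrite mulr_ge0//; first by rewrite /student_const; lra.
  by rewrite divr_ge0// ltW// (lt_trans ltr01).
pose e t := T_mean (tnth t) <= z.
have me : measurable_fun setT e by exact: measurable_T_mean_le.
have mJ := measurable_joint mX.
have meJ : measurable_fun setT (fun w => e (joint Xf w)) by exact: measurableT_comp.
have -> : [set w | T_mean (fun i => X i w) <= z] = [set w | e (joint Xf w)].
  apply/seteqP; split => w /=; rewrite /e.
    by rewrite (_ : tnth (joint Xf w) = fun i => X i w)//; apply/funext => i; rewrite tnth_mktuple.
  by rewrite (_ : tnth (joint Xf w) = fun i => X i w)//; apply/funext => i; rewrite tnth_mktuple.
rewrite prob_Ex// gauss_cdfE -EFinB lee_fin.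
(* the outer integral runs over the last [m2] observations *)
pose J : {pred 'I_(m1 + m2)} := [pred i : 'I_(m1 + m2) | (m1 <= i)%N].
have [Lh ->] := Ex_resampling mX indX J me.
set h := fun w => Ex Pr _ in Lh *.
have Ld : L1 Pr (fun w => (degenerate (joint Xf w))%:R).
  by apply: L1_bool; exact: (measurableT_comp measurable_degenerate).
rewrite -[gauss_cdf z](Ex_cst Pr) -ExB//; last exact: L1_cst.
rewrite -[leRHS]addr0 -degenerate_null -[X in X + _](Ex_cst Pr b) -ExD//; last exact: L1_cst.
apply: Ex_norm_le; [by apply: L1B => //; exact: L1_cst|by apply: L1D => //; exact: L1_cst|].
move=> w; have h01 : 0 <= h w <= 1.
  rewrite Ex_ge0//=; apply: Ex_bool_le1.
  by apply: (measurableT_comp me); apply: measurable_mix.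
have [deg|ndeg] := boolP (degenerate (joint Xf w)).
  have := gauss_cdf_ge0 z; have := gauss_cdf_le1 z; case/andP: h01 => *.
  by rewrite ler_norml; apply/andP; split; rewrite /=; lra.
rewrite addr0.
set a := direction (joint Xf w).
have a0 : a != origin R d by rewrite -dot_eq0.
pose Y i v := dot a (Xf (lshift m2 i) v).
have hE : h w = Ex Pr (fun v => (student (fun i => Y i v) <= z)%R%:R).
  apply: eq_Ex => v; rewrite /e T_mean_student.
  have -> : direction (mix J (joint Xf w) (joint Xf v)) = a.
    apply: eq_from_tnth => k; rewrite !tnth_mktuple; congr (_ * _).
    by apply: eq_bigr => j _; rewrite !tnth_mktuple inE/= leq_addr.
  congr (student _ <= z)%R%:R; apply/funext => i.
  by rewrite !tnth_mktuple inE/= leqNgt ltn_ord.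
have mdot : measurable_fun setT (fun x : d.-tuple R => dot a x).
  exact: measurable_dot.
have [sigma [s0 L3 M1 M2 M3]] := direction_moments L_gt1 PL a0.
have L3m : measurable_fun setT (fun x : d.-tuple R => `|dot a x| ^+ 3).
  by apply: measurable_funX; exact: (measurableT_comp (@normr_measurable R setT)).
have L2m : measurable_fun setT (fun x : d.-tuple R => dot a x ^+ 2).
  exact: measurable_funX.
have L2 : L1 P (fun x => dot a x ^+ 2).
  apply: (L1_le L2m (L1D (L1_cst _ 1) L3)) => x.
  by rewrite ger0_norm ?sqr_ge0//; exact: sqr_le_1cube.
have L1a : L1 P (fun x => dot a x).
  by apply: (L1_le mdot (L1D (L1_cst _ 1) L3)) => x; exact: normr_le_1cube.
rewrite hE; apply: (student_berry_esseen m1_gt0 z (sigma := sigma)) => //.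
- by move=> i; exact: measurableT_comp.
- apply: (independent_comp (f := fun _ x => dot a x)) => //.
  exact: (independent_lshift mX indX).
- by move=> i; exact: (law_L1 (lawX (lshift m2 i)) L3m L3).
- by move=> i; rewrite -M1; exact: (law_Ex (lawX (lshift m2 i)) mdot L1a).
- by move=> i; rewrite -M2; exact: (law_Ex (lawX (lshift m2 i)) L2m L2).
- exact: ltW.
- by move=> i; rewrite (le_trans _ M3)// -(law_Ex (lawX (lshift m2 i)) L3m L3).
Qed.

End main.

Unset Implicit Arguments.

Theorem theorem2p3 (R : realType) :
  exists C : R, 0 < C /\
    forall (L : R) (m1 m2 : nat), 1 < L -> (0 < m1)%N -> (0 < m2)%N ->
    (ereal_sup [set ereal_sup [set ereal_sup (cdf_errors m1 m2 P)
                              | P in @P0 R d L]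
               | d in [set d : nat | (1 <= d)%N]]
     <= (C * L / Num.sqrt m1%:R)%:E)%E.
Proof.
exists (student_const R); split.
  by have := stein_bound_ge2 R; rewrite /student_const; lra.
move=> L m1 m2 L1' m1_gt0 m2_gt0.
apply: ge_ereal_sup => _ [d _ <-]; apply: ge_ereal_sup => _ [P PL <-].
apply: ge_ereal_sup => _ [? [? [? [X [z [iidX ->]]]]]].
rewrite -mulrA; exact: T_mean_berry_esseen PL _ _ _ _ iidX z.
Qed.
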